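(* Let $\xi,\eta,\xi',\eta'\in\mathbb F_q^*$ and let $f\in\Phi$ have degree $2$. Let $\boldsymbol\lambda=(1)_{t-\xi}$, $\boldsymbol\mu=(1)_{t-\eta}$. For $\boldsymbol\nu\in\mathcal{P}(\Phi)$ with $\|\boldsymbol\nu\|=2$, we have $a^{\boldsymbol\nu}_{\boldsymbol\lambda\boldsymbol\mu}=0$ whenever the determinant of an element of modified type $\boldsymbol\nu$ differs from $\xi\eta$. Otherwise (i.e. when this determinant equals $\xi\eta$): $a^{(1)_{t-\xi'}\cup(1)_{t-\eta'}}_{\boldsymbol\lambda\boldsymbol\mu}$ equals $q-1$ if $\xi'\ne\eta'$ and $\{\xi',\eta'\}\ne\{\xi,\eta\}$; equals $2q-1$ if $\xi'\ne\eta'$ and $\{\xi',\eta'\}=\{\xi,\eta\}$; equals $q^2+q$ if $\xi'=\eta'=\xi=\eta$; and equals $0$ otherwise. Also $a^{(2)_{t-\xi'}}_{\boldsymbol\lambda\boldsymbol\mu}$ equals $q$ if $\xi'\notin\{\xi,\eta\}$ and $2q$ if $\xi'\in\{\xi,\eta\}$; and $a^{(1)_f}_{\boldsymbol\lambda\boldsymbol\mu}=q+1$.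
   Context: $q$ is a prime power, $G_n=GL_n(\mathbb F_q)$ with $G_m\subset G_n$ via $g\mapsto\mathrm{diag}(g,I_{n-m})$ (determinants of elements are thus independent of $n$). $\Phi$ is the set of monic irreducible polynomials in $\mathbb F_q[t]$ other than $t$, $d(f)$ its degree; $\mathcal{P}(\Phi)$ is the set of finitely supported maps $\boldsymbol\lambda$ from $\Phi$ to partitions, $\|\boldsymbol\lambda\|=\sum_f d(f)|\boldsymbol\lambda(f)|$, $\boldsymbol\lambda^e=\boldsymbol\lambda(t-1)$, $\ell$ = number of nonzero parts. For a partition $\rho$ and $f\in\Phi$, $(\rho)_f$ takes value $\rho$ at $f$ and $\emptyset$ elsewhere; $(\boldsymbol\lambda\cup\boldsymbol\mu)(f)=\boldsymbol\lambda(f)\cup\boldsymbol\mu(f)$ (union of parts). The type of $g\in G_n$ is the $\boldsymbol\lambda$ with $\mathbb F_q^n\cong\bigoplus_{f,i}\mathbb F_q[t]/(f^{\boldsymbol\lambda_i(f)})$ ($t$ acting by $g$); its modified type agrees with $\boldsymbol\lambda$ off $t-1$ and at $t-1$ is $(\boldsymbol\lambda^e_1-1,\dots,\boldsymbol\lambda^e_r-1)$ (zero parts discarded), $r=\ell(\boldsymbol\lambda^e)$. $K_{\boldsymbol\mu}(n)$ is the sum in $\mathbb Z[G_n]$ of all elements of modified type $\boldsymbol\mu$; the nonzero ones form a basis of the center of $\mathbb Z[G_n]$ with $K_{\boldsymbol\lambda}(n)K_{\boldsymbol\mu}(n)=\sum_{\boldsymbol\nu}a^{\boldsymbol\nu}_{\boldsymbol\lambda\boldsymbol\mu}(n)K_{\boldsymbol\nu}(n)$.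 For $\|\boldsymbol\nu\|=\|\boldsymbol\lambda\|+\|\boldsymbol\mu\|$, $a^{\boldsymbol\nu}_{\boldsymbol\lambda\boldsymbol\mu}(n)$ is independent of $n\ge\|\boldsymbol\nu\|+\ell(\boldsymbol\nu^e)$ and is denoted $a^{\boldsymbol\nu}_{\boldsymbol\lambda\boldsymbol\mu}$. *)

(* Defs.v *)
From HB Require Import structures.
From mathcomp Require Import all_boot all_order all_algebra.
From mathcomp Require Import boolp.
Set Implicit Arguments. Unset Strict Implicit. Unset Printing Implicit Defensive.
Import GRing.Theory.
Local Open Scope ring_scope.

Section GLtypes.
Variable F : finFieldType.

Definition qF : nat := #|F|.

Definition inPhi (f : {poly F}) : Prop :=
  f \is monic /\ irreducible_poly f /\ f <> 'X.

Definition pdeg (f : {poly F}) : nat := (size f).-1.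

Definition is_partition (s : seq nat) : bool :=
  sorted geq s && all (fun i => 0 < i)%N s.

Definition mpart := {poly F} -> seq nat.

Definition is_mpart_of_norm (nu : mpart) (k : nat) : Prop :=
  (forall f, is_partition (nu f)) /\
  (forall f, nu f <> [::] -> inPhi f) /\
  exists s : seq {poly F}, [/\ uniq s, (forall f, f \notin s -> nu f = [::]) &
     (\sum_(f <- s) pdeg f * sumn (nu f))%N = k].

Definition mp_single (rho : seq nat) (f : {poly F}) : mpart :=
  fun g => if g == f then rho else [::].

Definition mp_union (la mu : mpart) : mpart :=
  fun g => sort geq (la g ++ mu g).

Definition mp_e (nu : mpart) : seq nat := nu ('X - 1).

Definition mxpow n (A : 'M[F]_n) (k : nat) : 'M[F]_n := iter k (mulmx A) 1%:M.
Definition mxeval n (p : {poly F}) (A : 'M[F]_n) : 'M[F]_n :=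
  \sum_(i < size p) p`_i *: mxpow A i.

(* Type of g at f: determined from the ranks r_k = rank f(g)^k:
   m_k := (r_{k-1} - r_k) / d(f) is the number of parts >= k of lambda(f),
   and lambda(f)_i = #{k >= 1 | m_k >= i}.  This is the partition lambda(f)
   such that F^n = (+)_{f,i} F[t]/(f^{lambda_i(f)}) with t acting by g. *)
Definition gtype n (g : 'M[F]_n) (f : {poly F}) : seq nat :=
  let P := mxeval f g in
  let r k := \rank (mxpow P k) in
  let ms := [seq ((r k - r k.+1) %/ pdeg f)%N | k <- iota 0 n] in
  [seq count (leq i) ms | i <- iota 1 (head 0%N ms)].

Definition mtype n (g : 'M[F]_n) (f : {poly F}) : seq nat :=
  if f == 'X - 1 then [seq i.-1 | i <- gtype g f & (1 < i)%N] else gtype g f.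

Definition has_mtype n (g : 'M[F]_n) (nu : mpart) : Prop :=
  g \in unitmx /\ forall f, inPhi f -> mtype g f = nu f.

(* coefficient a^nu_{la mu}(n) of K_nu(n) in K_la(n) K_mu(n): the number of
   pairs (x, y) in G_n^2 with x of modified type la, y of modified type mu
   and x y = z, for z a (any) fixed element of modified type nu; it is 0 if
   K_nu(n) = 0 (no element of modified type nu). *)
Definition struct_const (n : nat) (la mu nu : mpart) : nat :=
  match [pick z : 'M[F]_n | `[< has_mtype z nu >]] with
  | Some z => #|[set xy : 'M[F]_n * 'M[F]_n |
                 [&& `[< has_mtype xy.1 la >], `[< has_mtype xy.2 mu >]
                   & xy.1 *m xy.2 == z]]|
  | None => 0%N
  end.

End GLtypes.

(* Main.v *)
Require Import Defs.
From HB Require Import structures.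
From mathcomp Require Import all_boot all_order all_algebra.
From mathcomp Require Import boolp.
From mathcomp Require Import zify ring.
Set Implicit Arguments. Unset Strict Implicit. Unset Printing Implicit Defensive.
Import GRing.Theory.
Local Open Scope ring_scope.

(** For [xi != 0] an element of modified type [(1)_{t-xi}] is exactly a matrix
    [x] with [\rank (x - 1) = 1] and [\det x = xi].  An element [z] whose modified
    type [nu] has norm 2 satisfies [\rank (z - 1) = 2]; writing [z = 1 + C B] with
    [C] of size n x 2 and [B] of size 2 x n, the 2 x 2 matrix [A = 1 + B C]
    describes the action of [z] on the image of [z - 1] and has (unmodified) type
    [nu].  If [x y = z] with [x], [y] of modified types [(1)_{t-xi}] and
    [(1)_{t-eta}], then [x - 1 = C S B] for a rank one idempotent [S] of size 2
    with [\tr (S A) = xi], and conversely when [\det A = xi * eta].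
    The structure constant is thus the number of such [S].  For scalar [A] all
    [q ^ 2 + q] rank one idempotents qualify or none does; otherwise [A] is similar
    to a companion matrix and the [S] are the points of an affine conic, which is
    parametrised by the lines through the origin. *)

(** * Types, conjugate partitions and ranks *)

(** For weakly decreasing [ms] this is the conjugate partition. [gtype] has this form, with the rank
    drops divided by the degree as [ms]. *)
Definition conj_parts (ms : seq nat) : seq nat :=
  [seq count (leq i) ms | i <- iota 1 (head 0%N ms)].

Lemma size_conj_parts ms : size (conj_parts ms) = head 0%N ms.
Proof. by rewrite size_map size_iota. Qed.

Lemma conj_parts_partition ms : is_partition (conj_parts ms).
Proof.
rewrite /is_partition /conj_parts; apply/andP; split.
  apply: (@homo_sorted _ _ _ ltn).
    by move=> i j /ltnW ij; apply: sub_count => k; apply: leq_trans.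
  exact: iota_ltn_sorted.
apply/allP => c /mapP[i]; rewrite mem_iota => ihead ->.
by case: ms ihead => [|m ms] /= ihead; lia.
Qed.

(** Double counting of a Young diagram: an entry [m] is the number of indices [i] with
    [1 <= i <= m], all in range because the first entry bounds [m]. *)
Lemma sumn_conj_parts ms :
  all (geq (head 0%N ms)) ms -> sumn (conj_parts ms) = sumn ms.
Proof.
rewrite /conj_parts; move: (head _ _) => N.
elim: ms => [_|m ms IH] /=.
  by elim: (iota 1 N) => //= i s ->.
case/andP => mN /IH <-.
have Em : m = sumn [seq nat_of_bool (i <= m)%N | i <- iota 1 N].
  rewrite sumn_count -[N in iota _ N](subnKC mN) iotaD count_cat.
  rewrite (eq_in_count (a2 := predT)); last by move=> i; rewrite mem_iota /=; lia.
  rewrite count_predT size_iota (eq_in_count (a2 := pred0)).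
    by rewrite count_pred0 addn0.
  by move=> i; rewrite mem_iota /=; lia.
rewrite [RHS]addnC [X in _ = (_ + X)%N]Em.
by elim: (iota 1 N) => //= i s IHs; lia.
Qed.

(** Lowering all parts by one deletes the first column of the diagram, whose length is the first
    entry of [ms]. *)
Lemma conj_parts_tail ms : sorted geq ms ->
  [seq i.-1 | i <- conj_parts ms & (1 < i)%N] = conj_parts (behead ms).
Proof.
case: ms => [|m [|m' ms]] //= msS.
  rewrite /conj_parts /= filter_map (eq_in_filter (a2 := pred0)) ?filter_pred0 //.
  by move=> i _ /=; lia.
rewrite /conj_parts [LHS]/= [in RHS]/= filter_map -map_comp.
have m'm : (m' <= m)%N by case/andP: msS.
have m'ms : all (geq m') ms.
  by case/andP: msS => _; rewrite path_sortedE => [/andP[] //|? ? ? /=]; lia.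
(* Indices up to the second entry [m'] are counted at least twice. Those between [m'] and [m] are
   counted once only, so their part is 1 and is discarded. *)
rewrite -(subnKC m'm) iotaD filter_cat (eq_in_filter (a2 := predT)); last first.
  by move=> i; rewrite mem_iota /=; lia.
rewrite filter_predT [X in _ ++ X](_ : _ = [::]).
  rewrite cats0; apply/eq_in_map => i; rewrite mem_iota /=; lia.
apply/eqP; rewrite -size_eq0 size_filter -leqn0 leqNgt -has_count.
apply/hasPn => i; rewrite mem_iota /= => im.
suff -> : count (leq i) ms = 0%N by lia.
apply/eqP; rewrite -leqn0 leqNgt -has_count; apply/hasPn => k /(allP m'ms) /=.
lia.
Qed.

(** Trailing zeros do not alter the conjugate. This makes types of matrices of different sizes
    comparable, since their lists of rank drops have different lengths. *)
Lemma conj_parts_iota (m : nat -> nat) N1 N2 :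
  (forall k, (minn N1 N2 <= k)%N -> m k = 0%N) ->
  conj_parts [seq m k | k <- iota 0 N1] = conj_parts [seq m k | k <- iota 0 N2].
Proof.
wlog N12 : N1 N2 / (N1 <= N2)%N.
  by move=> H mz; case/orP: (leq_total N1 N2) => NN;
    [|symmetry]; apply: H => // k kN; apply: mz; lia.
move=> mz; have {}mz k : (N1 <= k)%N -> m k = 0%N by move=> ?; apply: mz; lia.
rewrite -(subnKC N12) iotaD map_cat add0n.
have -> : [seq m k | k <- iota N1 (N2 - N1)] = nseq (N2 - N1) 0%N.
  apply: (@eq_from_nth _ 0%N); rewrite !size_map size_iota ?size_nseq // => i iN.
  by rewrite (nth_map 0%N) ?size_iota // nth_nseq nth_iota // mz ?leq_addr // if_same.
rewrite /conj_parts.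
have -> : head 0%N ([seq m k | k <- iota 0 N1] ++ nseq (N2 - N1) 0%N) =
          head 0%N [seq m k | k <- iota 0 N1].
  by case: (N1) => //=; case: (_ - _)%N.
apply/eq_in_map => i; rewrite mem_iota count_cat count_nseq => /andP[i0 _].
by rewrite leqNgt i0 /= addn0.
Qed.

Section MatrixTypes.
Variable F : finFieldType.
Implicit Types (f p : {poly F}) (a : F).

Lemma mxpowE n (A : 'M[F]_n.+1) k : mxpow A k = A ^+ k.
Proof. by elim: k => [|k IH]; rewrite ?expr0 // exprS -IH. Qed.

Lemma mxevalE n p (A : 'M[F]_n.+1) : mxeval p A = horner_mx A p.
Proof.
rewrite -{2}[p]coefK poly_def linear_sum; apply: eq_bigr => i _.
by rewrite mxpowE linearZ rmorphXn /= horner_mx_X.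
Qed.

Definition rank_drop n (P : 'M[F]_n.+1) k := (\rank (P ^+ k) - \rank (P ^+ k.+1))%N.

Lemma gtypeE n (A : 'M[F]_n.+1) f :
  gtype A f = conj_parts
    [seq (rank_drop (horner_mx A f) k %/ pdeg f)%N | k <- iota 0 n.+1].
Proof.
by rewrite /gtype; congr (conj_parts _); apply: eq_map => k; rewrite mxevalE !mxpowE.
Qed.

Section RankDrop.
Variables (n : nat) (P : 'M[F]_n.+1).

Lemma rank_expS k : (\rank (P ^+ k.+1) <= \rank (P ^+ k))%N.
Proof. by rewrite exprSr; apply: mxrankM_maxl. Qed.

(** The Frobenius rank inequality for [P], [P ^+ k], [P] says that the ranks of the powers of [P]
    form a convex sequence. *)
Lemma rank_dropS k : (rank_drop P k.+1 <= rank_drop P k)%N.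
Proof.
have := mxrank_Frobenius P (P ^+ k) P.
rewrite /rank_drop -[P *m _ *m P]/(P * P ^+ k * P) -[P *m _]/(P * P ^+ k) -[_ *m P]/(P ^+ k * P).
rewrite -exprS -!exprSr; have := rank_expS k; have := rank_expS k.+1; lia.
Qed.

Lemma rank_drop_leq i k : (i <= k)%N -> (rank_drop P k <= rank_drop P i)%N.
Proof.
elim: k => [|k IH]; first by rewrite leqn0 => /eqP->.
rewrite leq_eqVlt => /predU1P[-> //|ik].
by apply: leq_trans (rank_dropS k) _; apply: IH.
Qed.

Lemma sum_rank_drop k : (\sum_(i < k) rank_drop P i = n.+1 - \rank (P ^+ k))%N.
Proof.
elim: k => [|k IH]; first by rewrite big_ord0 expr0 mxrank1 subnn.
rewrite big_ord_recr /= IH /rank_drop; have := rank_expS k.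
have := rank_leq_row (P ^+ k); lia.
Qed.

(** A positive drop at [k] makes all earlier drops positive, and their sum would exceed the size of
    the matrix. *)
Lemma rank_drop_eq0 k : (n.+1 <= k)%N -> rank_drop P k = 0%N.
Proof.
move=> nk; apply/eqP; rewrite -leqn0 leqNgt; apply/negP => d0.
have : (k.+1 <= \sum_(i < k.+1) rank_drop P i)%N.
  rewrite -{1}[k.+1]card_ord -sum1_card; apply: leq_sum => i _.
  exact: leq_trans d0 (rank_drop_leq (ltn_ord i : (i <= k)%N)).
by rewrite sum_rank_drop; lia.
Qed.

End RankDrop.

Lemma gtype_partition n (A : 'M[F]_n.+1) f : is_partition (gtype A f).
Proof. by rewrite gtypeE conj_parts_partition. Qed.

Lemma size_gtype n (A : 'M[F]_n.+1) f :
  size (gtype A f) = ((n.+1 - \rank (horner_mx A f)) %/ pdeg f)%N.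
Proof. by rewrite gtypeE size_conj_parts /= /rank_drop expr0 expr1 mxrank1. Qed.

Lemma sumn_gtype n (A : 'M[F]_n.+1) f :
  sumn (gtype A f) = (\sum_(k < n.+1) rank_drop (horner_mx A f) k %/ pdeg f)%N.
Proof.
rewrite gtypeE sumn_conj_parts.
  rewrite sumnE big_map -(big_mkord xpredT (fun k => rank_drop _ k %/ pdeg f)%N).
  by rewrite /index_iota subn0.
by apply/allP => m /mapP[k _ ->] /=; apply/leq_div2r/rank_drop_leq.
Qed.

Lemma sumn_gtype_XsubC n (A : 'M[F]_n.+1) a :
  sumn (gtype A ('X - a%:P)) = (n.+1 - \rank ((A - a%:M) ^+ n.+1)%R)%N.
Proof.
rewrite sumn_gtype rmorphB /= horner_mx_X horner_mx_C -sum_rank_drop.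
by apply: eq_bigr => k _; rewrite /pdeg size_XsubC divn1.
Qed.

Lemma size_gtype_XsubC n (A : 'M[F]_n.+1) a :
  size (gtype A ('X - a%:P)) = (n.+1 - \rank (A - a%:M)%R)%N.
Proof.
by rewrite size_gtype rmorphB /= horner_mx_X horner_mx_C /pdeg size_XsubC divn1.
Qed.

(** Passing to the modified type removes the first entry from the list of rank drops, hence the
    shift to [k.+1]. *)
Lemma mtype1 n (A : 'M[F]_n.+1) :
  mtype A ('X - 1) =
  conj_parts [seq rank_drop (A - 1) k.+1 | k <- iota 0 n].
Proof.
rewrite /mtype eqxx gtypeE conj_parts_tail.
  rewrite /= -[iota 1 n]/(iota (1 + 0) n) iotaDl -map_comp rmorphB rmorph1 /= horner_mx_X.
  by congr conj_parts; apply: eq_map => k /=; rewrite /pdeg -polyC1 size_XsubC divn1.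
apply: (@homo_sorted _ _ _ ltn); last exact: iota_ltn_sorted.
by move=> i j ij /=; apply/leq_div2r/rank_drop_leq/ltnW.
Qed.

(* Sylvester's identity, from two block-triangular factorisations. *)
Lemma rank_scalar_addM n r c (C : 'M[F]_(n, r)) (D : 'M[F]_(r, n)) : c != 0 ->
  (\rank (c%:M + C *m D)%R + r = \rank (c%:M + D *m C)%R + n)%N.
Proof.
move=> c0.
pose X := block_mx (c%:M + C *m D) (0 : 'M_(n, r)) 0 (1%:M : 'M_r).
pose Y := block_mx (1%:M : 'M_n) (0 : 'M_(n, r)) 0 (c%:M + D *m C).
have rX : (\rank X = \rank (c%:M + C *m D)%R + r)%N by rewrite rank_diag_block_mx mxrank1.
have rY : (\rank Y = n + \rank (c%:M + D *m C)%R)%N by rewrite rank_diag_block_mx mxrank1.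
pose L1 := block_mx (1%:M : 'M_n) (- C) 0 (1%:M : 'M_r).
pose R1 := block_mx (1%:M : 'M_n) 0 D (1%:M : 'M_r).
pose Z := block_mx (c%:M : 'M_n) C (- D) (1%:M : 'M_r).
have uT m1 m2 (E : 'M[F]_(m1, m2)) : block_mx 1%:M E 0 1%:M \in unitmx.
  by rewrite unitmxE det_ublock !det1 mulr1 unitr1.
have lT m1 m2 (E : 'M[F]_(m2, m1)) : block_mx 1%:M 0 E 1%:M \in unitmx.
  by rewrite unitmxE det_lblock !det1 mulr1 unitr1.
have EX : L1 *m Z *m R1 = X.
  rewrite /L1 /R1 /Z /X !mulmx_block !(mul1mx, mulmx1, mul0mx, mulmx0, add0r, addr0).
  by rewrite !(mulNmx, mulmxN) opprK subrr mul0mx addr0 addNr.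
pose L2 := block_mx (1%:M : 'M_n) 0 D (c%:M : 'M_r).
pose R2 := block_mx (c^-1%:M : 'M_n) (- (c^-1 *: C)) 0 (1%:M : 'M_r).
have EY : L2 *m Z *m R2 = Y.
  rewrite /L2 /R2 /Z /Y !mulmx_block !(mul1mx, mulmx1, mul0mx, mulmx0, add0r, addr0).
  rewrite !(mulNmx, mulmxN) !mul_scalar_mx !mul_mx_scalar scale_scalar_mx mulrV ?unitfE //.
  rewrite -!scalemxAr -?scalemxAl scalerA mulrV ?unitfE // scale1r addNr subrr !mul0mx scaler0.
  by rewrite scaler0 oppr0 add0r [D *m C + _]addrC.
have rXZ : \rank X = \rank Z.
  rewrite -EX mxrankMfree ?row_free_unit ?lT //.
  by apply: eqmx_rank; apply/eqmxP/eqmxMfull; rewrite row_full_unit uT.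
have rYZ : \rank Y = \rank Z.
  rewrite -EY mxrankMfree ?row_free_unit; last first.
    by rewrite unitmxE det_ublock det1 mulr1 det_scalar unitrX ?unitfE ?invr_eq0.
  apply: eqmx_rank; apply/eqmxP/eqmxMfull; rewrite row_full_unit.
  by rewrite unitmxE det_lblock det1 mul1r det_scalar unitrX ?unitfE.
by rewrite -rX rXZ -rYZ rY addnC.
Qed.

(** Both sides are the determinant of the block matrix [Z], computed by eliminating one or the other
    diagonal block. *)
Lemma det_1addM n r (C : 'M[F]_(n, r)) (D : 'M[F]_(r, n)) :
  \det (1%:M + C *m D) = \det (1%:M + D *m C).
Proof.
pose Z := block_mx (1%:M : 'M_n) C (- D) (1%:M : 'M_r).
transitivity (\det Z).
  have -> : Z = block_mx (1%:M : 'M_n) C 0 1%:M *m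
      block_mx (1%:M + C *m D) 0 (- D) (1%:M : 'M_r).
    rewrite mulmx_block !(mul1mx, mulmx1, mul0mx, mulmx0, add0r, addr0).
    by rewrite mulmxN addrK.
  by rewrite det_mulmx det_ublock det_lblock !det1 !mulr1 mul1r.
have -> : Z = block_mx (1%:M : 'M_n) 0 (- D) 1%:M *m
    block_mx (1%:M : 'M_n) C 0 (1%:M + D *m C).
  rewrite mulmx_block !(mul1mx, mulmx1, mul0mx, mulmx0, add0r, addr0).
  by rewrite mulNmx addrCA addNr addr0.
by rewrite det_mulmx det_ublock det_lblock !det1 !mul1r.
Qed.

End MatrixTypes.

(** * Modified types and the action on the image of z - 1 *)

Section Compression.
Variable F : finFieldType.

Lemma horner_mx_intertwine n r (z : 'M[F]_n.+1) (A : 'M_r.+1) (C : 'M_(n.+1, r.+1)) p :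
  z *m C = C *m A -> horner_mx z p *m C = C *m horner_mx A p.
Proof.
move=> zC; elim/poly_ind: p => [|p c IH]; first by rewrite !rmorph0 mul0mx mulmx0.
rewrite !rmorphD !rmorphM /= !horner_mx_X !horner_mx_C mulmxDl mulmxDr.
by rewrite -mulmxA zC mulmxA IH -mulmxA scalar_mxC.
Qed.

Lemma rank_mul3 m n r s (C : 'M[F]_(m, n)) (M : 'M_(n, r)) (B : 'M_(r, s)) :
  row_full C -> row_free B -> \rank (C *m M *m B) = \rank M.
Proof.
move=> fC fB; rewrite mxrankMfree //.
by apply: eqmx_rank; apply/eqmxP/eqmxMfull.
Qed.

Lemma inPhi_root (f : {poly F}) a : inPhi f -> root f a -> f = 'X - a%:P.
Proof.
case=> fm [[_ firr] _]; rewrite root_factor_theorem => /firr; rewrite size_XsubC => /(_ isT).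
by rewrite eqp_monic ?monicXsubC // => /eqP.
Qed.

Lemma inPhi_XsubC (a : F) : a != 0 -> inPhi ('X - a%:P).
Proof.
move=> a0; split; first exact: monicXsubC.
split; first exact: irredp_XsubC.
move/(congr1 (fun p : {poly F} => p.[a])); rewrite !hornerE subrr => a_0.
by rewrite -a_0 eqxx in a0.
Qed.

Variables (n r : nat) (C : 'M[F]_(n.+1, r.+1)) (B : 'M[F]_(r.+1, n.+1)).
Hypotheses (fC : row_full C) (fB : row_free B).
Let z := 1%:M + C *m B.
Let A := 1%:M + B *m C.

(** [z - 1] is [C *m B], so its power [k.+1] is [C (B C)^k B], and the outer full rank factors
    preserve the rank. The shift of exponent matches the one in [mtype1]. *)
Lemma rank_compress1 k : \rank ((z - 1) ^+ k.+1) = \rank ((A - 1) ^+ k).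
Proof.
rewrite -(rank_mul3 _ fC fB); congr (\rank _).
rewrite /z /A ![1%:M + _]addrC !addrK.
elim: k => [|k IH]; first by rewrite expr0 expr1 mulmx1.
by rewrite exprS IH exprS -!mulmxE !mulmxA.
Qed.

(** Writing [p = p(1) + h (X - 1)], one gets [p(z) = p(1) + (C h(A)) B] and
    [p(A) = p(1) + B (C h(A))], and Sylvester's identity compares the two ranks. *)
Lemma rank_compress p : p.[1] != 0 ->
  (\rank (horner_mx z p) + r.+1 = \rank (horner_mx A p) + n.+1)%N.
Proof.
move=> p1.
have : root (p - p.[1]%:P) 1 by rewrite rootE !hornerE subrr.
case/factor_theorem => h ph.
have {}ph : p = p.[1]%:P + h * ('X - 1%:P) by rewrite -ph addrC subrK.
have zC : z *m C = C *m A.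
  by rewrite /z /A mulmxDl mulmxDr mul1mx mulmx1 mulmxA.
have -> : horner_mx z p = p.[1]%:M + (C *m horner_mx A h) *m B.
  rewrite {1}ph rmorphD rmorphM rmorphB /= horner_mx_X !horner_mx_C.
  by rewrite {2}/z [1%:M + _]addrC addrK -mulmxE mulmxA (horner_mx_intertwine _ zC).
have -> : horner_mx A p = p.[1]%:M + B *m (C *m horner_mx A h).
  rewrite {1}ph rmorphD mulrC rmorphM rmorphB /= horner_mx_X !horner_mx_C.
  by rewrite {1}/A [1%:M + _]addrC addrK -mulmxE mulmxA.
exact: rank_scalar_addM.
Qed.

(* On the image of [z - 1] the element [z] acts with type the modified type of
   [z]; [A] is the matrix of this action. *)
Lemma mtype_compress f : inPhi f -> mtype z f = gtype A f.
Proof.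
move=> fPhi; have [->|f1] := eqVneq f ('X - 1).
  have EA : horner_mx A ('X - 1) = A - 1 by rewrite rmorphB rmorph1 /= horner_mx_X.
  rewrite mtype1 gtypeE EA.
  have drop k : rank_drop (z - 1) k.+1 = rank_drop (A - 1) k.
    by rewrite /rank_drop !rank_compress1.
  rewrite (eq_map drop) /pdeg -polyC1 size_XsubC.
  rewrite [in RHS](eq_map (g := rank_drop (A - 1))) => [|k]; last exact: divn1.
  apply: conj_parts_iota => k; rewrite geq_min => /orP[|] k_ge.
    exact: etrans (esym (drop k)) (rank_drop_eq0 _ _).
  exact: rank_drop_eq0.
(* Away from ['X - 1] the ranks of the powers of [f(z)] and [f(A)] differ by a constant, so the rank
   drops agree. *)
have f_1 : f.[1] != 0.
  apply/negP => f_1; case/eqP: f1; rewrite -polyC1; exact: inPhi_root.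
rewrite /mtype (negPf f1) !gtypeE.
have drop k : rank_drop (horner_mx z f) k = rank_drop (horner_mx A f) k.
  have R i : (\rank (horner_mx z f ^+ i) + r.+1 = \rank (horner_mx A f ^+ i) + n.+1)%N.
    by rewrite -!rmorphXn rank_compress // horner_exp expf_neq0.
  rewrite /rank_drop; move: (R k) (R k.+1).
  move: (\rank (_ ^+ k)) (\rank (_ ^+ k.+1)) (\rank (_ ^+ k)) (\rank (_ ^+ k.+1)) => a b c d; lia.
rewrite (eq_map (fun k => congr1 (divn^~ _) (drop k))).
apply: conj_parts_iota => k; rewrite geq_min => /orP[|] k_ge.
  by rewrite -[rank_drop _ k]drop rank_drop_eq0 // div0n.
by rewrite rank_drop_eq0 // div0n.
Qed.

End Compression.

(** * Matrix sizes forced by types with small support *)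

Section TypeConstraints.
Variable F : finFieldType.
Implicit Types (f g p : {poly F}) (a b : F).

Section OneMatrix.
Variables (r : nat) (A : 'M[F]_r.+1).

Lemma coprime_horner_unit p g :
  coprimep p g -> horner_mx A p = 0 -> horner_mx A g \in unitmx.
Proof.
move=> /Bezout_eq1_coprimepP[[u v] /= uv] pA.
have := congr1 (horner_mx A) uv; rewrite rmorphD !rmorphM rmorph1 /= pA mulr0 add0r.
by move=> /mulmx1_unit[].
Qed.

(* A nonzero row vector killed by f(A) spans a cyclic submodule of dimension
   [deg f]. *)
Lemma gtype_nil_unit f :
  irreducible_poly f -> gtype A f = [::] -> horner_mx A f \in unitmx.
Proof.
move=> firr /(congr1 size); rewrite size_gtype /=; set P := horner_mx A f => fA.
have f1 : (1 < size f)%N by case: firr.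
have d0 : (0 < pdeg f)%N by rewrite /pdeg -subn1 subn_gt0.
rewrite -row_free_unit -kermx_eq0; apply/negP => /negP kP.
pose v := nz_row (kermx P).
have v0 : v != 0 by rewrite nz_row_eq0.
have vP : v *m P = 0 by apply/sub_kermxP/nz_row_sub.
pose V := \matrix_(i < pdeg f) (v *m A ^+ i).
have VE (u : 'rV_(pdeg f)) : u *m V = v *m horner_mx A (rVpoly u).
  rewrite horner_rVpoly [u *m V]mulmx_sum_row [u *m powers_mx _ _]mulmx_sum_row.
  rewrite linear_sum mulmx_sumr.
  apply: eq_bigr => i _; rewrite !rowK linearZ /= mxvecK -scalemxAr //.
have VP : (V <= kermx P)%MS.
  apply/row_subP => i; rewrite rowK; apply/sub_kermxP.
  rewrite -mulmxA (_ : A ^+ i *m P = P *m A ^+ i) ?mulmxA ?vP ?mul0mx //.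
  have -> : A ^+ i = horner_mx A 'X^i by rewrite rmorphXn /= horner_mx_X.
  by rewrite !mulmxE -!rmorphM mulrC.
have freeV : row_free V.
  apply: inj_row_free => u; rewrite VE => vu.
  apply/eqP; rewrite -[u]rVpolyK; apply/eqP; have [->|p0] := eqVneq (rVpoly u) 0.
    by rewrite linear0.
  (* A linear relation among the rows of [V] is a polynomial of degree below that of [f], hence
     coprime to [f]; a Bezout combination of the two would kill [v]. *)
  have cop : coprimep f (rVpoly u).
    rewrite irreducible_poly_coprime //; apply/negP => /dvdp_leq -/(_ p0).
    have : (size (rVpoly u) <= pdeg f)%N by apply: size_poly.
    move=> ud fu; have := leq_trans fu ud.
    by rewrite /pdeg -ltnS prednK ?ltnn // ltnW.
  case/Bezout_eq1_coprimepP: cop => [[s t] /= st].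
  case/eqP: v0; rewrite -[v]mulmx1 -[1%:M](rmorph1 (horner_mx A)) -st rmorphD mulrC.
  by rewrite [t * _]mulrC !rmorphM /= mulmxDr -!mulmxE !mulmxA vP vu !mul0mx addr0.
have := mxrankS VP; rewrite mxrank_ker (eqP freeV) => dP.
have : (1 <= (r.+1 - \rank P) %/ pdeg f)%N by rewrite divn_gt0.
by rewrite fA.
Qed.

(** Induction on the degree. An irreducible factor other than [f] and [g] is invertible at [A]: for
    ['X] since [A] is invertible, and otherwise because its type is empty. *)
Lemma factor_out f g p : A \in unitmx -> f \is monic -> g \is monic ->
  (forall h, inPhi h -> h <> f -> h <> g -> gtype A h = [::]) -> p != 0 ->
  exists u i j, p = u * f ^+ i * g ^+ j /\ horner_mx A u \in unitmx.
Proof.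
move=> uA fm gm others.
elim: {p}(size p) {-2}p (leqnn (size p)) => [|m IH] p pm p0.
  by move: pm p0; rewrite leqn0 size_poly_eq0 => ->.
have [p1|p1] := leqP (size p) 1.
  have : size p == 1%N by rewrite eqn_leq p1 size_poly_gt0.
  case/size_poly1P => c c0 ->; exists c%:P, 0%N, 0%N.
  by rewrite !expr0 !mulr1 horner_mx_C unitmxE det_scalar unitrX ?unitfE.
have [pirr|] := pselect (irreducible_poly p); last first.
  move/not_andP => [//|] /existsNP[h] /not_implyP[h1] /not_implyP[/dvdpP[k pk] hp].
  have k0 : k != 0 by apply: contraNneq p0 => k0; rewrite pk k0 mul0r.
  have h0 : h != 0 by apply: contraNneq p0 => h0; rewrite pk h0 mulr0.
  have sp : size p = (size k + size h).-1 by rewrite pk size_mul.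
  have sk : size k <> 1%N.
    move/eqP/size_poly1P => [c c0 kc]; case: hp.
    by rewrite pk kc mul_polyC eqp_sym eqp_scale.
  have sk0 : (0 < size k)%N by rewrite size_poly_gt0.
  have sh0 : (0 < size h)%N by rewrite size_poly_gt0.
  have arith : (size k <= m)%N /\ (size h <= m)%N.
    move/eqP: h1; move: sp sk sk0 sh0 pm p1.
    by move: (size p) (size k) (size h) => x y w; lia.
  have [|//|u [i [j [kE uu]]]] := IH k; first exact: arith.1.
  have [|//|u' [i' [j' [hE uu']]]] := IH h; first exact: arith.2.
  exists (u * u'), (i + i')%N, (j + j')%N; split; first by rewrite pk kE hE !exprD; ring.
  by rewrite rmorphM unitmx_mul uu.
pose c := lead_coef p; pose h := c^-1 *: p.
have c0 : c != 0 by rewrite lead_coef_eq0.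
have ph : p = c%:P * h by rewrite mul_polyC scalerA divff ?scale1r.
have hm : h \is monic by rewrite monicE lead_coefZ mulVf.
have uc : horner_mx A c%:P \in unitmx.
  by rewrite horner_mx_C unitmxE det_scalar unitrX ?unitfE.
have [hf|hf] := eqVneq h f; first by exists c%:P, 1%N, 0%N; rewrite expr1 mulr1 -hf.
have [hg|hg] := eqVneq h g; first by exists c%:P, 0%N, 1%N; rewrite expr1 mulr1 -hg.
exists p, 0%N, 0%N; rewrite !expr0 !mulr1; split => //.
rewrite ph rmorphM unitmx_mul uc /=.
have [->|hX] := eqVneq h 'X; first by rewrite horner_mx_X.
have hirr : irreducible_poly h.
  have hp : h %= p by rewrite eqp_scale ?invr_eq0.
  split; first by rewrite (eqp_size hp).
  by move=> q q1; rewrite (eqp_dvdr q hp) (eqp_rtrans hp); apply: pirr.2.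
apply: gtype_nil_unit => //.
by apply: others; [split; [|split => //; apply/eqP]|apply/eqP|apply/eqP].
Qed.

(** Cayley-Hamilton, after cancelling the invertible cofactor of the powers of [f] and [g] in the
    characteristic polynomial. The case [f = g] is allowed. *)
Lemma supported_types_annihilate f g : A \in unitmx -> f \is monic -> g \is monic ->
  (forall h, inPhi h -> h <> f -> h <> g -> gtype A h = [::]) ->
  exists i j, horner_mx A f ^+ i *m horner_mx A g ^+ j = 0.
Proof.
move=> uA fm gm others.
have [u [i [j [Eu uu]]]] := factor_out uA fm gm others (monic_neq0 (char_poly_monic A)).
exists i, j; apply: (row_full_inj (_ : row_full (horner_mx A u))).
  by rewrite row_full_unit.
by rewrite mulmx0 -!rmorphXn mulmxA !mulmxE -!rmorphM -Eu /= Cayley_Hamilton.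
Qed.

Lemma rank_exp_stable (P : 'M[F]_r.+1) k :
  (r.+1 <= k)%N -> \rank (P ^+ k) = \rank (P ^+ r.+1).
Proof.
move=> rk; rewrite -(subnKC rk); elim: (k - _)%N => [|j IH]; first by rewrite addn0.
rewrite addnS -IH; apply/eqP; rewrite eqn_leq rank_expS -subn_eq0.
by rewrite -/(rank_drop P (r.+1 + j)) rank_drop_eq0 ?leq_addr.
Qed.

Lemma rank_exp_geq (P : 'M[F]_r.+1) k : (\rank (P ^+ r.+1) <= \rank (P ^+ k))%N.
Proof.
have [/rank_exp_stable-> //|kr] := leqP r.+1 k.
suff: (\rank (P ^+ (k + (r.+1 - k))) <= \rank (P ^+ k))%N by rewrite subnKC // ltnW.
move: (r.+1 - k)%N => j.
elim: j => [|j IH]; first by rewrite addn0.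
by rewrite addnS; apply: leq_trans (rank_expS _ _) IH.
Qed.

(** [A - a] is nilpotent, so the generalised eigenspace of [a] is the whole space. *)
Lemma size_eigen_single a : A \in unitmx ->
  (forall h, inPhi h -> h <> 'X - a%:P -> gtype A h = [::]) ->
  sumn (gtype A ('X - a%:P)) = r.+1.
Proof.
move=> uA others; set f := 'X - a%:P.
have [i [j]] := supported_types_annihilate uA (monicXsubC a) (monicXsubC a)
  (fun h hP ha _ => others h hP ha).
rewrite mulmxE -exprD rmorphB /= horner_mx_X horner_mx_C => A0.
have := rank_exp_geq (A - a%:M) (i + j); rewrite A0 mxrank0 leqn0 => /eqP rk.
by rewrite sumn_gtype_XsubC rk subn0.
Qed.

(** All powers of [A - a] and [A - b] have rank at least [r], while some product of such powers
    vanishes. Sylvester's inequality gives [2 r <= r + 1], and for [r = 0] the matrix would equal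
    both [a] and [b]. *)
Lemma size_eigen_pair a b : a != b -> A \in unitmx ->
  (forall h, inPhi h -> h <> 'X - a%:P -> h <> 'X - b%:P -> gtype A h = [::]) ->
  gtype A ('X - a%:P) = [:: 1%N] -> gtype A ('X - b%:P) = [:: 1%N] -> r = 1%N.
Proof.
move=> ab uA others ga gb.
have [i [j]] := supported_types_annihilate uA (monicXsubC a) (monicXsubC b) others.
rewrite !rmorphB /= horner_mx_X !horner_mx_C => A0.
have := mxrank_mul_min ((A - a%:M) ^+ i) ((A - b%:M) ^+ j); rewrite A0 mxrank0.
have := rank_exp_geq (A - a%:M) i; have := rank_exp_geq (A - b%:M) j.
have := congr1 sumn ga; have := congr1 sumn gb; rewrite !sumn_gtype_XsubC /=.
move=> sa sb ra rb rab.
have : (r <= 1)%N by lia.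
case: r A ga gb => [|r'] A' ga gb //; last by lia.
have := congr1 size ga; have := congr1 size gb; rewrite !size_gtype_XsubC /= => da db.
case/eqP: ab.
have /eqP : \rank (A' - a%:M)%R = 0%N by lia.
have /eqP : \rank (A' - b%:M)%R = 0%N by lia.
rewrite !mxrank_eq0 !subr_eq0 => /eqP-> /eqP/matrixP/(_ 0 0).
by rewrite !mxE.
Qed.

(** The truncated divisions in [gtype] determine rank drops only up to a remainder; the absence of
    roots of [f] removes this ambiguity. *)
Lemma size_irreducible2 f : A \in unitmx -> inPhi f -> pdeg f = 2%N ->
  (forall h, inPhi h -> h <> f -> gtype A h = [::]) ->
  gtype A f = [:: 1%N] -> r = 1%N /\ horner_mx A f = 0.
Proof.
move=> uA fPhi f2 others gf.
have [fm [firr _]] := fPhi.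
have noroot a : ~~ root f a.
  by apply/negP => /(inPhi_root fPhi) fa; move: f2; rewrite fa /pdeg size_XsubC.
have [i [j]] := supported_types_annihilate uA fm fm (fun h hP hf _ => others h hP hf).
have sf := congr1 size gf; have := congr1 sumn gf.
rewrite sumn_gtype; move: sf; rewrite size_gtype f2 mulmxE -exprD.
set P : 'M[F]_r.+1 := horner_mx A f; set k := (i + j)%N => /= rP.
have r0 : (0 < r)%N.
  by move: rP (leq_subr (\rank P) r.+1); move: (r.+1 - _)%N => x; lia.
rewrite big_ord_recl /= {1}/rank_drop expr0 expr1 mxrank1 rP.
move=> sumP P0.
(* The first drop already accounts for the whole sum 1, so half of the second drop truncates to
   0. *)
have d1 : (rank_drop P 1 <= 1)%N.
  move: sumP; rewrite (bigD1 (Ordinal r0)) //= /bump /= addn0.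
  by move: (rank_drop P 1) => x; lia.
have PA : P *m A = A *m P.
  by rewrite /P -{2 3}[A]horner_mx_X !mulmxE -!rmorphM mulrC.
(* Were the drop 1, the image and kernel of [P] would meet in a line stable under [A], whose
   eigenvalue is a root of [f]. *)
have d0 : rank_drop P 1 = 0%N.
  apply/eqP; rewrite -leqn0 leqNgt; apply/negP => dgt.
  have dE : \rank (P :&: kermx P)%MS = 1%N.
    have := mxrank_mul_ker P P; move: dgt d1; rewrite /rank_drop expr1 expr2 -mulmxE.
    move: (\rank P) (\rank (P *m P)) (\rank _) => x y w; lia.
  set U := (P :&: kermx P)%MS in dE.
  have UA : (U *m A <= U)%MS.
    rewrite sub_capmx; apply/andP; split.
      apply: (submx_trans (submxMr A (capmxSl P (kermx P)))).
      by rewrite PA submxMl.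
    apply/sub_kermxP; rewrite -mulmxA -PA mulmxA.
    by rewrite (sub_kermxP (capmxSr P (kermx P))) mul0mx.
  pose u := nz_row U.
  have u0 : u != 0 by rewrite nz_row_eq0 -mxrank_eq0 dE.
  have uU : (U <= u)%MS.
    by rewrite -(geq_leqif (mxrank_leqif_sup (nz_row_sub U))) dE rank_rV u0.
  have /sub_rVP[c uc] : (u *m A <= u)%MS.
    by apply: submx_trans uU; apply: submx_trans UA; apply/submxMr/nz_row_sub.
  have up p : u *m horner_mx A p = p.[c] *: u.
    elim/poly_ind: p => [|p e IH]; first by rewrite rmorph0 mulmx0 horner0 scale0r.
    rewrite rmorphD rmorphM /= horner_mx_X horner_mx_C mulmxDr mulmxA IH -scalemxAl uc.
    by rewrite scalerA mul_mx_scalar -scalerDl !hornerE.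
  have : u *m P = 0 by apply/sub_kermxP; apply: submx_trans (nz_row_sub U) (capmxSr _ _).
  rewrite up => /eqP; rewrite scaler_eq0 (negPf u0) orbF => fc.
  by have := noroot c; rewrite rootE fc.
have rank_stable m : \rank (P ^+ m.+1) = \rank P.
  elim: m => [|m IH] //; rewrite -IH; apply/eqP; rewrite eqn_leq rank_expS -subn_eq0.
  by rewrite -/(rank_drop P m.+1) -leqn0 -d0 rank_drop_leq.
have Pz : P = 0.
  apply/eqP; rewrite -mxrank_eq0 -(rank_stable k) exprS P0 mulr0 mxrank0 //.
split => //; move: rP; rewrite Pz mxrank0 subn0 => r2.
(* Size 3 is excluded: [f] would be the minimal polynomial, and the linear cofactor in the cubic
   characteristic polynomial would give it a root. *)
have : r = 1%N \/ r = 2%N by lia.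
case=> // rE.
have fmin : mxminpoly A = f.
  apply/eqP; rewrite -eqp_monic ?mxminpoly_monic //; apply: firr.2.
    by rewrite size_mxminpoly eqSS -lt0n mxminpoly_nonconstant.
  exact: mxminpoly_min.
have /dvdpP[h hE] : f %| char_poly A by rewrite -fmin mxminpoly_dvd_char.
have h0 : h != 0.
  apply: contraTneq (char_poly_monic A) => h0.
  by rewrite hE h0 mul0r monicE lead_coef0 eq_sym oner_eq0.
have := size_char_poly A; rewrite hE size_mul ?(irredp_neq0 firr) // rE => sh.
have : size h = 2%N by move: f2; rewrite /pdeg; move: (size h) (size f) sh => x y ; lia.
case/poly2_root => c hc; have := noroot c.
by rewrite -fmin root_mxminpoly hE rootM hc.
Qed.
End OneMatrix.
End TypeConstraints.

(** * Rank one idempotents of size 2 *)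

Section TwoByTwo.
Variable F : finFieldType.
Implicit Types (a b c d s x t u xi eta : F).

Definition mx22 a b c d : 'M[F]_2 :=
  \matrix_(i, j) if i == 0 then (if j == 0 then a else b) else (if j == 0 then c else d).

Lemma mx22E (A : 'M[F]_2) : A = mx22 (A 0 0) (A 0 1) (A 1 0) (A 1 1).
Proof.
apply/matrixP => i j; rewrite mxE.
by case: (unliftP 0 i) (unliftP 0 j) => [i' ->|->] [j' ->|->];
  rewrite ?ord1 //=; congr (A _ _); apply: val_inj.
Qed.

Lemma mx22_inj a b c d a' b' c' d' :
  mx22 a b c d = mx22 a' b' c' d' -> [/\ a = a', b = b', c = c' & d = d'].
Proof.
move/matrixP => E.
by split; [have := E 0 0|have := E 0 1|have := E 1 0|have := E 1 1]; rewrite !mxE.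
Qed.

Lemma mul_mx22 a b c d a' b' c' d' : mx22 a b c d *m mx22 a' b' c' d' =
  mx22 (a * a' + b * c') (a * b' + b * d') (c * a' + d * c') (c * b' + d * d').
Proof.
rewrite [LHS]mx22E; congr mx22; rewrite !mxE !big_ord_recl big_ord0 addr0 !mxE //.
Qed.

Lemma add_mx22 a b c d a' b' c' d' : mx22 a b c d + mx22 a' b' c' d' =
  mx22 (a + a') (b + b') (c + c') (d + d').
Proof. by rewrite [LHS]mx22E !mxE. Qed.

Lemma scalar_mx22 a : a%:M = mx22 a 0 0 a.
Proof. by rewrite [LHS]mx22E !mxE. Qed.

Lemma tr_mx22 a b c d : \tr (mx22 a b c d) = a + d.
Proof. by rewrite /mxtrace !big_ord_recl big_ord0 addr0 !mxE. Qed.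

Lemma det_2 (R : comNzRingType) (A : 'M[R]_2) :
  \det A = A 0 0 * A 1 1 - A 0 1 * A 1 0.
Proof.
rewrite (expand_det_row _ 0) !big_ord_recl big_ord0 addr0 /cofactor !det_mx11 !mxE /=.
rewrite expr0 mul1r expr1 mulN1r mulrN; congr (A _ _ * A _ _ - A _ _ * A _ _);
by apply: val_inj.
Qed.

Lemma det_opp2 (A : 'M[F]_2) : \det (- A) = \det A.
Proof. by rewrite -scaleN1r detZ sqrrN expr1n mul1r. Qed.

Lemma det_mx22 a b c d : \det (mx22 a b c d) = a * d - b * c.
Proof. by rewrite det_2 !mxE. Qed.

Lemma char_poly_mx22 a b c d :
  char_poly (mx22 a b c d) = 'X ^+ 2 - (a + d) *: 'X + (a * d - b * c)%:P.
Proof.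
rewrite /char_poly det_2 !mxE /= -mul_polyC.
rewrite !(polyCD, polyCM, polyCN) ; ring.
Qed.

Lemma det_1add_mx22 (M : 'M[F]_2) : \det (1%:M + M) = 1 + \tr M + \det M.
Proof.
rewrite [M]mx22E; move: (M 0 0) (M 0 1) (M 1 0) (M 1 1) => a b c d.
rewrite scalar_mx22 add_mx22 !det_mx22 tr_mx22; ring.
Qed.

Lemma rank_mx22_eq1 (S : 'M[F]_2) : (\rank S == 1%N) = (S != 0) && (\det S == 0).
Proof.
rewrite -mxrank_eq0 -[\det S == 0]negbK -unitfE -unitmxE -row_free_unit /row_free.
have := rank_leq_row S; move: (\rank S) => k.
by case: k => [|[|[|]]].
Qed.

Lemma rank_mx22_trace1 (S : 'M[F]_2) : \tr S = 1 -> \det S = 0 -> \rank S = 1%N.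
Proof.
move=> t d; apply/eqP; rewrite rank_mx22_eq1 d eqxx andbT; apply/eqP => S0.
by move: t; rewrite S0 mxtrace0 => /eqP; rewrite eq_sym oner_eq0.
Qed.

(** By Cayley-Hamilton, trace 1 and determinant 0 characterise the rank one idempotents of size
    2. *)
Definition cset (A : 'M[F]_2) xi : {set 'M[F]_2} :=
  [set S | [&& \tr S == 1, \det S == 0 & \tr (S *m A) == xi]].

Lemma csetP A xi S :
  reflect [/\ \tr S = 1, \det S = 0 & \tr (S *m A) = xi] (S \in cset A xi).
Proof.
by rewrite inE; apply: (iffP and3P) => [[/eqP-> /eqP-> /eqP->]|[-> -> ->]].
Qed.

Lemma card_cset_conj (P A K : 'M[F]_2) xi : P \in unitmx -> P *m A = K *m P ->
  #|cset A xi| = #|cset K xi|.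
Proof.
move=> uP PA.
have inj : injective (fun S : 'M[F]_2 => invmx P *m S *m P).
  move=> S T /(congr1 (fun U => P *m U *m invmx P)).
  by rewrite /= !mulmxA mulmxV // !mul1mx !(mulmxK uP).
rewrite -[RHS](card_imset _ inj); apply: eq_card => S; apply/idP/imsetP.
  move=> /csetP[t d tA]; exists (P *m S *m invmx P); last first.
    by rewrite !mulmxA mulVmx // mul1mx mulmxKV.
  apply/csetP; split.
  - by rewrite mxtrace_mulC mulmxA mulVmx // mul1mx.
  - by rewrite !det_mulmx d mulr0 mul0r.
  by rewrite mxtrace_mulC !mulmxA -PA -!mulmxA mxtrace_mulC -!mulmxA mulVmx // mulmx1 mxtrace_mulC.
case=> T /csetP[t d tA] ->; apply/csetP; split.
- by rewrite -mulmxA mxtrace_mulC -mulmxA mulmxV // mulmx1.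
- by rewrite !det_mulmx d mulr0 mul0r.
by rewrite -!mulmxA PA mxtrace_mulC -!mulmxA mulmxV // mulmx1.
Qed.

Definition comp22 t d := mx22 0 1 (- d) t.

(** The rows of [P] are [e] and [e A] for a cyclic row vector [e]: [(1, 0)] if [b] is nonzero,
    [(0, 1)] if [c] is, and [(1, 1)] for a diagonal matrix with distinct entries. *)
Lemma nonscalar_conj_comp22 (A : 'M[F]_2) : (forall a, A <> a%:M) ->
  exists2 P : 'M[F]_2, P \in unitmx & P *m A = comp22 (\tr A) (\det A) *m P.
Proof.
rewrite [A]mx22E; move: (A 0 0) (A 0 1) (A 1 0) (A 1 1) => a b c d ns.
rewrite tr_mx22 det_mx22 /comp22.
have [b0|b0] := eqVneq b 0; last first.
  exists (mx22 1 0 a b); first by rewrite unitmxE det_mx22 unitfE mul1r mul0r subr0.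
  rewrite !mul_mx22; congr mx22; ring.
have [c0|c0] := eqVneq c 0; last first.
  exists (mx22 0 1 c d); first by rewrite unitmxE det_mx22 unitfE mul0r mul1r sub0r oppr_eq0.
  rewrite !mul_mx22; congr mx22; ring.
exists (mx22 1 1 (a + c) (b + d)).
  rewrite unitmxE det_mx22 unitfE !mul1r b0 c0 addr0 add0r subr_eq0.
  by apply/eqP => da; apply: (ns a); rewrite b0 c0 da scalar_mx22.
rewrite !mul_mx22; congr mx22; ring.
Qed.

Lemma card_cset_scalar a xi :
  #|cset a%:M xi| = (if a == xi then #|F| ^ 2 + #|F| else 0)%N.
Proof.
case: eqP => [<-|axi]; last first.
  apply: eq_card0 => S; apply/negP => /csetP[t _].
  by rewrite mul_mx_scalar linearZ /= t mulr1.
(* For nonzero [b] the diagonal entry [x] is free and the lower left entry is forced. For [b = 0]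
   the diagonal is [(1, 0)] or [(0, 1)] and the lower left entry is free; [inl (x, 0)] and [inr x]
   encode these two lines. *)
pose h (y : (F * F) + F) := match y with
  | inl (x, b) => if b == 0 then mx22 1 0 x 0 else mx22 x b (x * (1 - x) / b) (1 - x)
  | inr x => mx22 0 0 x 1 end.
have inj : injective h.
  move=> [[x b]|x] [[x' b']|x'] /=.
  - case: eqP => [->|b0]; case: eqP => [->|b0'].
    + by case/mx22_inj => _ _ ->.
    + by case/mx22_inj => _ b0''; case: b0'.
    + by case/mx22_inj => _ b0''; case: b0.
    + by case/mx22_inj => -> ->.
  - case: eqP => [->|b0]; case/mx22_inj => //.
    by move=> /eqP; rewrite oner_eq0.
  - case: eqP => [->|b0]; case/mx22_inj => //.
      by move=> /eqP; rewrite eq_sym oner_eq0.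
    by move=> _ /esym.
  - by case/mx22_inj => _ _ ->.
have -> : (#|F| ^ 2 + #|F|)%N = #|{: (F * F) + F}| by rewrite card_sum card_prod mulnn.
rewrite -cardsT -[RHS](card_imset _ inj); apply: eq_card => S; apply/idP/imsetP.
  move=> /csetP[]; rewrite [S]mx22E.
  move: (S 0 0) (S 0 1) (S 1 0) (S 1 1) => x b c y; rewrite tr_mx22 det_mx22.
  move=> /(canRL (addKr x)); rewrite addrC => -> /eqP; rewrite subr_eq0 => /eqP bc _.
  have [b0|b0] := eqVneq b 0; last first.
    exists (inl (x, b)) => //=; rewrite (negPf b0) bc; congr mx22.
    by rewrite mulrC mulKf.
  move: bc; rewrite b0 mul0r => /eqP; rewrite mulf_eq0 subr_eq0 => /orP[/eqP->|/eqP<-].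
    by exists (inr c) => //=; rewrite subr0.
  by exists (inl (c, 0)) => //=; rewrite eqxx subrr.
move=> [y _ ->]; rewrite inE mul_mx_scalar linearZ /=.
have trh : \tr (h y) = 1.
  case: y => [[x b]|x] /=; rewrite ?(fun_if (@mxtrace _ _)) !tr_mx22 ?addr0 ?add0r //.
  by rewrite addrC subrK if_same.
rewrite trh mulr1 !eqxx andbT /=.
case: y {trh} => [[x b]|x] /=; last by rewrite det_mx22 !mul0r subrr.
have [_|b0] := eqVneq b 0; rewrite det_mx22; first by rewrite mulr0 mul0r subrr.
by rewrite mulrCA divff ?mulr1 ?subrr.
Qed.

(* With [S = mx22 (1 - x) b _ x] the conditions become the conic
   [x^2 - t x b + d b^2 = x - xi b] through the origin, parametrised by the
   slope [s = x / b]. *)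
Lemma card_cset_comp22 t d xi : let p : {poly F} := 'X ^+ 2 - t *: 'X + d%:P in
  #|cset (comp22 t d) xi| =
  (2 + #|[set s | (p.[s] != 0%R) && (s != xi)]| + (p.[xi] == 0%R) * (#|F| - 1))%N.
Proof.
move=> p.
have pE s : p.[s] = s ^+ 2 - t * s + d by rewrite /p !hornerE.
pose con := [set y : F * F | y.1 ^+ 2 - t * (y.1 * y.2) + d * y.2 ^+ 2 == y.1 - xi * y.2].
pose h (y : F * F) := mx22 (1 - y.1) y.2 (xi + y.2 * d - y.1 * t) y.1.
have inj : injective h by move=> [x b] [x' b'] /mx22_inj /= [_ -> _ ->].
have -> : #|cset (comp22 t d) xi| = #|con|.
  rewrite -[RHS](card_imset _ inj); apply: eq_card => S; apply/idP/imsetP.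
    move=> /csetP[]; rewrite [S]mx22E.
    move: (S 0 0) (S 0 1) (S 1 0) (S 1 1) => y b c x.
    rewrite mul_mx22 !tr_mx22 det_mx22 => /(canRL (addrK x)) -> dt trE.
    have cE : c = xi + b * d - x * t by rewrite -trE; ring.
    exists (x, b); last by rewrite /h /= cE.
    rewrite inE /= -subr_eq0; apply/eqP; rewrite -[RHS]oppr0 -dt cE; ring.
  case=> [[x b]]; rewrite inE /= => /eqP E ->; apply/csetP.
  rewrite /h /= mul_mx22 !tr_mx22 det_mx22.
  split; [by rewrite subrK| |ring].
  move/eqP: E; rewrite -subr_eq0 => /eqP E; rewrite -[RHS]oppr0 -E; ring.
rewrite -(cardsID [set y | y.2 == 0] con).
have -> : con :&: [set y | y.2 == 0] = [set (0, 0); (1, 0)].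
  apply/setP => -[x b]; rewrite !inE /= !xpair_eqE.
  have [->|b0] := eqVneq b 0; last by rewrite !andbF.
  rewrite !andbT expr0n /= !mulr0 subr0 addr0 subr0 expr2 -subr_eq0.
  by rewrite -{3}[x]mulr1 -mulrBr mulf_eq0 subr_eq0.
rewrite cards2 xpair_eqE eqxx andbT eq_sym oner_eq0 /= -addnA; congr (_ + _)%N.
(* The first coordinate is now the slope [s = x / b]; dividing the conic equation by [b] leaves
   [b p(s) = s - xi]. *)
pose con' := [set y : F * F | (y.2 != 0) && (y.2 * p.[y.1] == y.1 - xi)].
have -> : #|con :\: [set y | y.2 == 0]| = #|con'|.
  have inj' : {in con' &, injective (fun y : F * F => (y.1 * y.2, y.2))}.
    move=> [s b] [s' b']; rewrite !inE /= => /andP[b0 _] _ [] + bb; rewrite -bb.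
    by move/(mulIf b0) ->.
  rewrite -[RHS](card_in_imset inj'); apply: eq_card => -[x b]; apply/idP/imsetP.
    rewrite !inE /= => /andP[b0 /eqP E]; exists (x / b, b); last by rewrite /= divfK.
    rewrite inE /= b0 /= pE; apply/eqP/(mulfI b0).
    transitivity (x ^+ 2 - t * (x * b) + d * b ^+ 2); first by field.
    by rewrite E; field.
  case=> [[s b']]; rewrite !inE /= => /andP[b0 /eqP E] [-> ->]; rewrite b0 /=.
  apply/eqP; transitivity (b' * (b' * p.[s])); first by rewrite pE; ring.
  by rewrite E; ring.
have -> : #|con'| = (\sum_s #|[set b | (b != 0%R) && (b * p.[s] == s - xi)%R]|)%N.
  transitivity (\sum_s \sum_(b | (b != 0%R) && (b * p.[s] == s - xi)%R) 1)%N.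
    by rewrite pair_big_dep -sum1_card; apply: eq_bigl => y; rewrite inE.
  by apply: eq_bigr => s _; rewrite -sum1_card; apply: eq_bigl => b; rewrite inE.
(* A slope [s] other than [xi] with [p(s)] nonzero carries one point; the slope [xi] carries all
   nonzero [b] if it is a root of [p]; no other slope carries any. *)
transitivity (\sum_s (((p.[s] != 0%R) && (s != xi)) +
                      (s == xi) * ((p.[xi] == 0%R) * (#|F| - 1))))%N; last first.
  rewrite big_split /=; congr (_ + _)%N.
    by rewrite -sum1_card [RHS]big_mkcond; apply: eq_bigr => s _; rewrite inE; case: (_ && _).
  rewrite (bigD1 xi) //= eqxx mul1n big1 ?addn0 // => s /negPf->.
  by rewrite mul0n.
apply: eq_bigr => s _; have [->|sxi] := eqVneq s xi.
  rewrite andbF add0n mul1n; have [->|p0] := eqVneq p.[xi] 0.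
    rewrite mul1n subn1 -(cardsC1 (0 : F)); apply: eq_card => b.
    by rewrite !inE mulr0 subrr eqxx andbT.
  rewrite mul0n; apply: eq_card0 => b; rewrite inE subrr mulf_eq0 (negPf p0) orbF.
  by rewrite andNb.
rewrite andbT mul0n addn0; have [->|p0] := eqVneq p.[s] 0.
  apply: eq_card0 => b; rewrite inE mulr0 [0 == _]eq_sym subr_eq0 (negPf sxi) andbF //.
rewrite [RHS](_ : _ = #|[set (s - xi) / p.[s]]|); last by rewrite cards1.
apply: eq_card => b; rewrite !inE.
apply/andP/eqP => [[_ /eqP <-]|->]; first by rewrite mulfK.
by rewrite divfK // eqxx mulf_neq0 ?invr_eq0 // subr_eq0.
Qed.

(** * Factorisations of [z] and rank one idempotents *)

Section Pairs.
Variables (n : nat) (C : 'M[F]_(n, 2)) (B : 'M[F]_(2, n)) (xi eta : F).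
Hypotheses (fC : row_full C) (fB : row_free B).
Let z := 1%:M + C *m B.
Let A := 1%:M + B *m C.

(** The row space of [E] has dimension 2 and lies in the sum of those of [R] and [Q], which has
    dimension at most 2, so the two coincide. *)
Lemma rank1_summand_sub m (D : 'M[F]_(m, 2)) (E : 'M_(2, n)) (R Q : 'M_(m, n)) :
  row_full D -> row_free E -> D *m E = R + Q -> \rank R = 1%N -> \rank Q = 1%N ->
  (R <= E)%MS.
Proof.
move=> fD fE DE rR rQ.
have ERQ : (E <= R + Q)%MS.
  rewrite -[E]mul1mx -(mulVpmx fD) -mulmxA DE; apply: submx_trans (submxMl _ _) _.
  by apply: addmx_sub_adds.
apply: submx_trans (addsmxSl R Q) _; rewrite -(geq_leqif (mxrank_leqif_sup ERQ)).
by rewrite (eqP fE); apply: leq_trans (mxrank_adds_leqif R Q) _; rewrite rR rQ.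
Qed.

Lemma card_pairs : xi != 0 -> eta != 0 -> \det A = xi * eta ->
  #|[set xy : 'M[F]_n * 'M[F]_n |
      [&& (\rank (xy.1 - 1)%R == 1%N) && (\det xy.1 == xi),
          (\rank (xy.2 - 1)%R == 1%N) && (\det xy.2 == eta) & xy.1 *m xy.2 == z]]|
  = #|cset A xi|.
Proof.
move=> xi0 eta0 dA.
have [C' C'C] := row_fullP fC; have [B' BB'] := row_freeP fB.
have dz : \det z = xi * eta by rewrite /z det_1addM.
pose X (S : 'M[F]_2) := 1%:M + C *m S *m B.
have detX S : \tr S = 1 -> \det S = 0 -> \det (X S) = \tr (S *m A).
  move=> t d; rewrite /X -mulmxA det_1addM det_1add_mx22 -mulmxA det_mulmx d mul0r addr0.
  by rewrite /A mulmxDr mulmx1 linearD /= t.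
pose h S := (X S, invmx (X S) *m z).
have inj : injective h.
  move=> S T [+ _] => /addrI /(congr1 (fun M => C' *m M *m B')).
  by rewrite !mulmxA C'C !mul1mx -!mulmxA BB' !mulmx1.
rewrite -[RHS](card_imset _ inj); apply: eq_card => -[x y]; rewrite inE /=; apply/idP/imsetP.
  case/and3P => /andP[/eqP rx /eqP dx] /andP[/eqP ry /eqP dy] /eqP xy.
  have ux : x \in unitmx by rewrite unitmxE dx unitfE.
  (* [Q] is [x (y - 1)], hence of rank one, and [R + Q = z - 1]. *)
  pose R := x - 1; pose Q := z - x.
  have CB : C *m B = R + Q by rewrite /R /Q addrC addrA subrK /z addrC addKr.
  have rQ : \rank Q = 1%N.
    rewrite /Q -xy -[x in X in _ - X]mulmx1 -mulmxBr -ry.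
    by apply: eqmx_rank; apply/eqmxP/eqmxMfull; rewrite row_full_unit.
  have /submxP[V RB] := rank1_summand_sub fC fB CB rx rQ.
  (* The same argument on transposes puts the column space of [R] inside that of [C], so [R] factors
     through both [C] and [B]. *)
  have RC : (R^T <= C^T)%MS.
    apply: (@rank1_summand_sub _ B^T _ _ Q^T); rewrite ?mxrank_tr //.
    - by rewrite /row_full mxrank_tr.
    - by rewrite /row_free mxrank_tr.
    by rewrite -trmx_mul CB linearD.
  case/submxP: RC => U /(congr1 trmx); rewrite trmxK trmx_mul trmxK => RU.
  pose S := C' *m R *m B'.
  have CSB : C *m S *m B = R.
    have -> : C *m S *m B = C *m (C' *m R) *m (B' *m B) by rewrite /S !mulmxA.
    rewrite {1}RU (mulmxA C') C'C mul1mx -RU RB -!mulmxA (mulmxA B) BB' mul1mx //.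
  have xX : x = X S by rewrite /X CSB /R addrC subrK.
  have rS : \rank S = 1%N by rewrite -(rank_mul3 S fC fB) CSB.
  have CSB' : C *m (1%:M - S) *m B = Q.
    by rewrite mulmxBr mulmxBl mulmx1 CSB CB addrAC subrr add0r.
  have rS' : \rank (1%:M - S)%R = 1%N by rewrite -(rank_mul3 _ fC fB) CSB'.
  have dS : \det S = 0 by move/eqP: rS; rewrite rank_mx22_eq1 => /andP[_ /eqP].
  (* [1 - S] is singular too, so [1 - \tr S + \det S] vanishes. *)
  have tS : \tr S = 1.
    move/eqP: rS'; rewrite rank_mx22_eq1 det_1add_mx22 => /andP[_].
    by rewrite det_opp2 dS linearN addr0 subr_eq0 => /eqP.
  exists S; first by apply/csetP; split => //; rewrite -detX // -xX.
  by rewrite /h -xX -xy mulKmx.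
case=> S /csetP[tS dS tA] [-> ->].
have dX : \det (X S) = xi by rewrite detX.
have uX : X S \in unitmx by rewrite unitmxE dX unitfE.
have XE : X S - 1 = C *m S *m B by rewrite /X addrC addKr.
have xyz : X S *m (invmx (X S) *m z) = z by rewrite mulmxA mulmxV // mul1mx.
have YE : invmx (X S) *m z - 1 = invmx (X S) *m (C *m (1%:M - S) *m B).
  have -> : C *m (1%:M - S) *m B = z - X S.
    by rewrite mulmxBr mulmxBl mulmx1 /z /X opprD addrACA subrr add0r.
  by rewrite mulmxBr mulVmx.
apply/and3P; split; last by rewrite xyz.
  by rewrite XE rank_mul3 // rank_mx22_trace1 // dX !eqxx.
apply/andP; split.
  rewrite YE (eqmx_rank (_ : (_ == C *m (1%:M - S) *m B)%MS)); last first.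
    by apply/eqmxP/eqmxMfull; rewrite row_full_unit unitmx_inv.
  rewrite rank_mul3 // rank_mx22_trace1 //.
    by rewrite linearB /= mxtrace1 tS; ring.
  by rewrite det_1add_mx22 det_opp2 linearN /= tS dS addr0 subrr.
by apply/eqP/(mulfI xi0); rewrite -[in LHS]dX -det_mulmx xyz.
Qed.
End Pairs.
End TwoByTwo.

(** * Modified types of norm 1 and 2 *)

Section Decomposition.
Variable F : finFieldType.
Implicit Types (f g p : {poly F}) (a b c : F) (nu : mpart F).

Lemma horner_mx_scalar n c p : horner_mx (c%:M : 'M[F]_n.+1) p = p.[c]%:M.
Proof.
elim/poly_ind: p => [|p e IH]; first by rewrite rmorph0 horner0 raddf0.
rewrite rmorphD rmorphM /= horner_mx_X horner_mx_C IH !hornerE.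
by rewrite -[_ * _]scalar_mxM -raddfD.
Qed.

Lemma scalar_mx_unit n c : c != 0 -> (c%:M : 'M[F]_n) \in unitmx.
Proof. by move=> c0; rewrite unitmxE det_scalar unitrX ?unitfE. Qed.

Lemma gtype_unit n (A : 'M[F]_n.+1) f : horner_mx A f \in unitmx -> gtype A f = [::].
Proof. by move=> u; apply/size0nil; rewrite size_gtype mxrank_unit // subnn div0n. Qed.

Lemma inPhi_root0 f a : inPhi f -> f <> 'X - a%:P -> f.[a] != 0.
Proof. by move=> fP fa; apply/negP => /(inPhi_root fP). Qed.

Lemma mtype_one n f : inPhi f -> mtype (1 : 'M[F]_n.+1) f = [::].
Proof.
move=> fP; have [->|f1] := eqVneq f ('X - 1).
  apply/size0nil; rewrite mtype1 size_conj_parts; case: n => [|n] //=.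
  by rewrite /rank_drop subrr expr1 mxrank0.
rewrite /mtype (negPf f1) gtype_unit // -[1]/(1%:M) horner_mx_scalar scalar_mx_unit //.
by apply: inPhi_root0 => //; apply/eqP; rewrite polyC1.
Qed.

Lemma rank_one_compress n (z : 'M[F]_n.+1) : z != 1 ->
  exists r (C : 'M[F]_(n.+1, r.+1)) (B : 'M[F]_(r.+1, n.+1)),
    [/\ row_full C, row_free B, z = 1%:M + C *m B & \rank (z - 1) = r.+1].
Proof.
rewrite -subr_eq0 -mxrank_eq0 => z1.
have : exists (C : 'M[F]_(n.+1, \rank (z - 1))) (B : 'M[F]_(\rank (z - 1), n.+1)),
    [/\ row_full C, row_free B & z = 1%:M + C *m B].
  exists (col_base (z - 1)), (row_base (z - 1)).
  by rewrite col_base_full row_base_free mulmx_base addrC subrK.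
move: z1; case: (\rank (z - 1)) => // r _ [C [B [fC fB zE]]].
by exists r, C, B.
Qed.

Lemma mtype_compression n (z : 'M[F]_n.+1) nu f :
  has_mtype z nu -> inPhi f -> nu f <> [::] ->
  exists r (C : 'M[F]_(n.+1, r.+1)) (B : 'M[F]_(r.+1, n.+1)),
    [/\ row_full C, row_free B, z = 1%:M + C *m B, \rank (z - 1) = r.+1 &
        1%:M + B *m C \in unitmx /\
        forall g, inPhi g -> gtype (1%:M + B *m C) g = nu g].
Proof.
move=> [uz zt] fP nuf; have z1 : z != 1.
  by apply/eqP => z1; apply: nuf; rewrite -zt // z1 mtype_one.
have [r [C [B [fC fB zE rz]]]] := rank_one_compress z1.
exists r, C, B; split=> //; split; first by rewrite unitmxE -det_1addM -zE -unitmxE.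
by move=> g gP; rewrite -zt // zE mtype_compress.
Qed.

Lemma mp_single_same (rho : seq nat) f : mp_single rho f f = rho.
Proof. by rewrite /mp_single eqxx. Qed.

Lemma mp_single_other (rho : seq nat) f g : g <> f -> mp_single rho f g = [::].
Proof. by rewrite /mp_single => /eqP/negPf->. Qed.

Lemma partition_size1 s : size s = 1%N -> s = [:: sumn s].
Proof. by case: s => [|k []] //= _; rewrite addn0. Qed.

Lemma partition_size2 s : is_partition s -> size s = 2%N -> sumn s = 2%N ->
  s = [:: 1%N; 1%N].
Proof.
case: s => [|i [|j []]] //= /andP[_ /= /and3P[i0 j0 _]] _ ij.
by congr [:: _; _]; lia.
Qed.

(* Both sides describe [x = 1 + u v] with [u] a column, [v] a row and
   [1 + v u = xi]. *)
Lemma has_mtype_reflection n (x : 'M[F]_n.+1) c : c != 0 ->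
  has_mtype x (mp_single [:: 1%N] ('X - c%:P)) <->
  (\rank (x - 1)%R == 1%N) && (\det x == c).
Proof.
move=> c0; set nu := mp_single _ _; split.
  move=> xt; have cP := inPhi_XsubC c0.
  have nuc : nu ('X - c%:P) = [:: 1%N] by apply: mp_single_same.
  have [|r [C [B [fC fB xE rx [uA At]]]]] := mtype_compression xt cP; first by rewrite nuc.
  have rE : sumn (gtype (1%:M + B *m C) ('X - c%:P)) = r.+1.
    by apply: size_eigen_single => // h hP hc; rewrite At // /nu mp_single_other.
  move: rE; rewrite At // nuc => -[r0]; rewrite rx -r0 eqxx /=.
  subst r; have := congr1 sumn (At _ cP); rewrite nuc sumn_gtype_XsubC expr1 /= => /eqP.
  rewrite xE det_1addM; set A := 1%:M + B *m C => rA.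
  have : \rank (A - c%:M) == 0%N by move: rA; case: (\rank _) => [|k]; rewrite // addn0; lia.
  by rewrite mxrank_eq0 subr_eq0 => /eqP->; rewrite det_scalar1.
case/andP => /eqP rx /eqP dx; split; first by rewrite unitmxE dx unitfE.
have [|r [C [B [fC fB xE]]]] := @rank_one_compress _ x.
  by rewrite -subr_eq0 -mxrank_eq0 rx.
rewrite rx => -[r0]; subst r; move: dx; rewrite xE det_1addM => dA f fP.
rewrite mtype_compress //.
have -> : 1%:M + B *m C = c%:M by rewrite [LHS]mx11_scalar -det_mx11 dA.
have [->|/eqP fc] := eqVneq f ('X - c%:P).
  rewrite /nu mp_single_same [LHS]partition_size1.
    by rewrite sumn_gtype_XsubC expr1 subrr mxrank0.
  by rewrite size_gtype_XsubC subrr mxrank0.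
rewrite /nu mp_single_other // gtype_unit // horner_mx_scalar scalar_mx_unit //.
exact: inPhi_root0.
Qed.

(** The index is the characteristic polynomial of the 2 x 2 matrix attached to an element of
    modified type [nu]; its value at 0 is the determinant of that element. *)
Inductive norm2_shape nu : {poly F} -> Prop :=
| Shape_single a : a != 0 -> nu ('X - a%:P) = [:: 2%N] \/ nu ('X - a%:P) = [:: 1%N; 1%N] ->
    (forall h, h <> 'X - a%:P -> nu h = [::]) ->
    norm2_shape nu (('X - a%:P) * ('X - a%:P))
| Shape_pair a b : a != 0 -> b != 0 -> a != b ->
    nu ('X - a%:P) = [:: 1%N] -> nu ('X - b%:P) = [:: 1%N] ->
    (forall h, h <> 'X - a%:P -> h <> 'X - b%:P -> nu h = [::]) ->
    norm2_shape nu (('X - a%:P) * ('X - b%:P))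
| Shape_irreducible f : inPhi f -> pdeg f = 2%N -> nu f = [:: 1%N] ->
    (forall h, h <> f -> nu h = [::]) -> norm2_shape nu f.

Lemma is_partition_sum1 s : is_partition s -> sumn s = 1%N -> s = [:: 1%N].
Proof.
case: s => [|i [|j s]] //=; first by rewrite addn0 => _ ->.
by move=> /andP[_ /= /and3P[i0 j0 _]]; lia.
Qed.

Lemma is_partition_sum2 s : is_partition s -> sumn s = 2%N ->
  s = [:: 2%N] \/ s = [:: 1%N; 1%N].
Proof.
case: s => [|i [|j [|k s]]] //=.
- by rewrite addn0 => _ ->; left.
- move=> /andP[_ /= /and3P[i0 j0 _]] ij; right; congr [:: _; _]; lia.
by move=> /andP[_ /= /and4P[i0 j0 k0 _]]; lia.
Qed.

Lemma sumn_partition_gt0 s : is_partition s -> s <> [::] -> (0 < sumn s)%N.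
Proof. by case: s => [|i s] //= /andP[_ /= /andP[i0 _]] _; lia. Qed.

Lemma inPhi_pdeg_gt0 f : inPhi f -> (0 < pdeg f)%N.
Proof. by case=> _ [[f1 _] _]; rewrite /pdeg -subn1 subn_gt0. Qed.

Lemma inPhi_pdeg1 f : inPhi f -> pdeg f = 1%N -> exists2 a, a != 0 & f = 'X - a%:P.
Proof.
move=> fP f1; have sf : size f = 2%N.
  by move: (inPhi_pdeg_gt0 fP) f1; rewrite /pdeg; case: (size f) => [|[|[|]]].
have [a fa] := poly2_root sf; have fE := inPhi_root fP fa.
exists a => //; apply/eqP => a0; case: fP => _ [_]; case.
by rewrite fE a0 subr0.
Qed.

(** Each polynomial in the support contributes at least 1 to the norm, so there are one or two of
    them; two must each have degree 1 and partition [(1)]. *)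
Lemma norm2_shape_exists nu : is_mpart_of_norm nu 2 -> exists p, norm2_shape nu p.
Proof.
move=> [nuP [nuPhi [s [us off sE]]]].
have term f : nu f <> [::] -> (0 < pdeg f * sumn (nu f))%N.
  by move=> nf; rewrite muln_gt0 inPhi_pdeg_gt0 ?sumn_partition_gt0 //; apply: nuPhi.
have ins f : nu f <> [::] -> f \in s.
  by move=> nf; apply/negP => /negP /off.
have [f fs nf] : exists2 f, f \in s & nu f <> [::].
  apply: contrapT => H; move: sE; rewrite big_seq big1 // => f fs.
  have [->|nf] := eqVneq (nu f) [::]; first by rewrite muln0.
  by case: H; exists f => //; apply/eqP.
move: sE; rewrite (bigD1_seq f) //=; set rest := (\sum_(i <- s | _) _)%N => sE.
have fP := nuPhi _ nf.
have tf := term f nf; have [rest0|rest_gt0] := posnP rest.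
  have others h : h <> f -> nu h = [::].
    move=> hf; apply: contrapT => nh; have := term h nh.
    have hfs : h \in [seq i <- s | i != f] by rewrite mem_filter ins // andbT; apply/eqP.
    move: rest0; rewrite /rest -big_filter (bigD1_seq h) ?filter_uniq //=.
    lia.
  have : (pdeg f * sumn (nu f) = 2)%N by lia.
  case E: (pdeg f) => [|[|[|d]]]; [lia| | |case: (sumn _); lia].
    have [a a0 fa] := inPhi_pdeg1 fP E; rewrite mul1n => sf.
    exists (('X - a%:P) * ('X - a%:P)); subst f; apply: Shape_single => //.
    exact: is_partition_sum2.
  move=> sf; exists f; apply: Shape_irreducible => //.
  by apply: is_partition_sum1 => //; lia.
have [g gs /andP[gf ng]] : exists2 g, g \in s & (g != f) && (nu g != [::]).
  apply: contrapT => H; move: rest_gt0; rewrite /rest big_seq_cond big1 // => g /andP[gs gf].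
  have [->|ng] := eqVneq (nu g) [::]; first by rewrite muln0.
  by case: H; exists g => //; rewrite gf.
move/eqP: ng => ng; have tg := term g ng; have gP := nuPhi _ ng.
move: sE; rewrite /rest -big_filter (bigD1_seq g) ?filter_uniq ?mem_filter ?gf //=.
rewrite -big_filter; set s' := [seq i <- _ | _]; set rest' := (\sum_(i <- s') _)%N => sE.
have rest0 : rest' = 0%N by lia.
have others h : h <> f -> h <> g -> nu h = [::].
  move=> hf hg; apply: contrapT => nh; have := term h nh.
  have hs : h \in s' by rewrite !mem_filter ins // andbT; apply/andP; split; apply/eqP.
  move: rest0; rewrite /rest' (bigD1_seq h) ?filter_uniq //=.
  lia.
have ff : (pdeg f * sumn (nu f) == 1)%N by apply/eqP; lia.
have gg : (pdeg g * sumn (nu g) == 1)%N by apply/eqP; lia.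
move: ff gg; rewrite !muln_eq1 => /andP[/eqP df /eqP sf] /andP[/eqP dg /eqP sg].
have [a a0 fa] := inPhi_pdeg1 fP df; have [b b0 gb] := inPhi_pdeg1 gP dg.
exists (('X - a%:P) * ('X - b%:P)); subst f g; apply: Shape_pair => //.
- by apply: contraNneq gf => ->.
- exact: is_partition_sum1.
- exact: is_partition_sum1.
Qed.

End Decomposition.

(** * The 2 x 2 matrix attached to a modified type of norm 2 *)

Section Norm2.
Variable F : finFieldType.
Implicit Types (f g p : {poly F}) (a b c xi eta : F) (nu : mpart F).

Lemma char_poly_2 (A : 'M[F]_2) : char_poly A = 'X ^+ 2 - (\tr A) *: 'X + (\det A)%:P.
Proof. by rewrite [A]mx22E char_poly_mx22 tr_mx22 det_mx22. Qed.

Lemma det_char_poly_2 (A : 'M[F]_2) : \det A = (char_poly A).[0].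
Proof. by rewrite char_poly_2 !hornerE expr0n /= subr0 add0r. Qed.

Lemma char_poly_2_root (A : 'M[F]_2) a : root (char_poly A) a ->
  exists b, char_poly A = ('X - a%:P) * ('X - b%:P).
Proof.
have cm := char_poly_monic A; have sc := size_char_poly A.
case/factor_theorem => h hE.
have hm : h \is monic by rewrite -(monicMr _ (monicXsubC a)) -hE.
have sh : size h = 2%N.
  by move: sc; rewrite hE size_Mmonic ?monicXsubC ?monic_neq0 // size_XsubC addn2 => -[].
have [b /factor_theorem[k kE]] := poly2_root sh.
have km : k \is monic by rewrite -(monicMr _ (monicXsubC b)) -kE.
have : size k = 1%N.
  by move: sh; rewrite kE size_Mmonic ?monicXsubC ?monic_neq0 // size_XsubC addn2 => -[].
move/eqP/size_poly1P => [c _ kc]; move: km; rewrite kc monicE lead_coefC => /eqP c1.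
by exists b; rewrite hE kE kc c1 mul1r mulrC.
Qed.

Lemma gtype_root n (A : 'M[F]_n.+1) a :
  gtype A ('X - a%:P) <> [::] -> root (char_poly A) a.
Proof.
move=> gA; rewrite -eigenvalue_root_char; apply: contraT; rewrite negbK => kA.
case: gA; apply: gtype_unit.
by rewrite rmorphB /= horner_mx_X horner_mx_C -row_free_unit -kermx_eq0.
Qed.

Lemma mtype_norm2 n (z : 'M[F]_n.+1) nu p : norm2_shape nu p -> has_mtype z nu ->
  exists (C : 'M[F]_(n.+1, 2)) (B : 'M[F]_(2, n.+1)),
    [/\ row_full C, row_free B, z = 1%:M + C *m B, char_poly (1%:M + B *m C) = p &
        forall g, inPhi g -> gtype (1%:M + B *m C) g = nu g].
Proof.
move=> sh zt; case: sh => [a a0 nua others|a b a0 b0 ab nua nub others|f fP f2 nuf others].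
- have aP := inPhi_XsubC a0.
  have [|r [C [B [fC fB zE _ [uA At]]]]] := mtype_compression zt aP; first by case: nua => ->.
  have : sumn (gtype (1%:M + B *m C) ('X - a%:P)) = r.+1.
    by apply: size_eigen_single => // h hP ha; rewrite At // others.
  have s2 : sumn (nu ('X - a%:P)) = 2%N by case: nua => ->.
  rewrite At // s2 => -[r1]; subst r; exists C, B; split => //.
  set A := 1%:M + B *m C in uA At *.
  have ra : root (char_poly A) a by apply: gtype_root; rewrite At //; case: nua => ->.
  have [b E] := char_poly_2_root ra; rewrite E.
  have rb : root (char_poly A) b by rewrite E rootM !root_XsubC eqxx orbT.
  (* This makes [a] the only root of the minimal polynomial, so the second root [b] equals [a]. *)
  have A2 : (A - a%:M) ^+ 2 = 0.
    apply/eqP; rewrite -mxrank_eq0; have := sumn_gtype_XsubC A a; rewrite At // s2.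
    have := rank_leq_row ((A - a%:M) ^+ 2); move: (\rank _) => k; lia.
  have : mxminpoly A %| ('X - a%:P) ^+ 2.
    by apply: mxminpoly_min; rewrite rmorphXn rmorphB /= horner_mx_X horner_mx_C.
  case/dvdpP => k kE; have : root (('X - a%:P) ^+ 2) b.
    by rewrite kE rootM root_mxminpoly rb orbT.
  by rewrite rootE horner_exp expf_eq0 /= !hornerE subr_eq0 => /eqP->.
- have aP := inPhi_XsubC a0; have bP := inPhi_XsubC b0.
  have [|r [C [B [fC fB zE _ [uA At]]]]] := mtype_compression zt aP; first by rewrite nua.
  have r1 : r = 1%N.
    apply: (size_eigen_pair ab uA); rewrite ?At // => h hP ha hb.
    by rewrite At // others.
  subst r; exists C, B; split => //; set A := 1%:M + B *m C in uA At *.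
  have ra : root (char_poly A) a by apply: gtype_root; rewrite At // nua.
  have rb : root (char_poly A) b by apply: gtype_root; rewrite At // nub.
  have [c E] := char_poly_2_root ra; move: rb; rewrite E rootM !root_XsubC eq_sym (negPf ab).
  by move/eqP->.
have [|r [C [B [fC fB zE _ [uA At]]]]] := mtype_compression zt fP; first by rewrite nuf.
have [r1 fA] : r = 1%N /\ horner_mx (1%:M + B *m C) f = 0.
  by apply: size_irreducible2; rewrite ?At // => h hP hf; rewrite At // others.
subst r; exists C, B; split => //; set A := 1%:M + B *m C in uA At fA *.
have [fm [firr _]] := fP.
have mf : mxminpoly A %= f.
  apply: firr.2; first by rewrite size_mxminpoly eqSS -lt0n mxminpoly_nonconstant.
  exact: mxminpoly_min.
have fchar : f %| char_poly A by rewrite -(eqp_dvdl _ mf) mxminpoly_dvd_char.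
apply/eqP; rewrite -eqp_monic ?char_poly_monic // eqp_sym -dvdp_size_eqp //.
rewrite size_char_poly; move: f2; rewrite /pdeg; case: (size f) => // k /= ->.
by rewrite eqxx.
Qed.

Lemma gtype_char_poly_2 (A : 'M[F]_2) f : inPhi f -> coprimep f (char_poly A) ->
  gtype A f = [::].
Proof.
move=> fP cop; apply: gtype_unit; apply: coprime_horner_unit (Cayley_Hamilton A).
by rewrite coprimep_sym.
Qed.

Lemma coprimep_inPhi_XsubC f a : inPhi f -> f <> 'X - a%:P -> coprimep f ('X - a%:P).
Proof. by move=> fP fa; rewrite coprimep_XsubC rootE inPhi_root0. Qed.

Lemma size_gtype_root (A : 'M[F]_2) a : (forall c, A <> c%:M) ->
  root (char_poly A) a -> size (gtype A ('X - a%:P)) = 1%N.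
Proof.
move=> ns ra; rewrite size_gtype_XsubC.
have r0 : \rank (A - a%:M)%R != 0%N by rewrite mxrank_eq0 subr_eq0; apply/eqP.
have : ~~ row_free (A - a%:M).
  by move: ra; rewrite -eigenvalue_root_char /eigenvalue kermx_eq0.
rewrite /row_free; move: r0 (rank_leq_row (A - a%:M)); move: (\rank _) => k.
by case: k => [|[|[|]]].
Qed.

(** Companion matrices realise all shapes except two parts equal to 1 at the same eigenvalue, which
    a scalar matrix realises. *)
Lemma norm2_matrix nu p : norm2_shape nu p ->
  exists2 A : 'M[F]_2, char_poly A = p & forall f, inPhi f -> gtype A f = nu f.
Proof.
have ns t d c : comp22 t d <> c%:M.
  by rewrite scalar_mx22 => /mx22_inj[_ /eqP]; rewrite oner_eq0.
have comp_char t d : char_poly (comp22 t d) = 'X ^+ 2 - t *: 'X + d%:P.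
  by rewrite /comp22 char_poly_mx22 mul0r add0r sub0r mul1r opprK.
have comp_prod a b :
    char_poly (comp22 (a + b) (a * b)) = ('X - a%:P) * ('X - b%:P).
  rewrite comp_char -mul_polyC polyCD polyCM; ring.
case=> [a a0 [nua|nua] others|a b a0 b0 ab nua nub others|f fP f2 nuf others].
- exists (comp22 (a + a) (a * a)) => [//|g gP]; set A := comp22 _ _.
  have [->|/eqP ga] := eqVneq g ('X - a%:P); last first.
    by rewrite gtype_char_poly_2 ?others // comp_prod coprimepMr coprimep_inPhi_XsubC.
  rewrite nua [LHS]partition_size1.
    rewrite sumn_gtype_XsubC (_ : (A - a%:M) ^+ 2 = 0) ?mxrank0 //.
    have := Cayley_Hamilton A; rewrite comp_prod -expr2 rmorphXn rmorphB /=.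
    by rewrite horner_mx_X horner_mx_C.
  by apply: size_gtype_root; [apply: ns|rewrite comp_prod rootM root_XsubC eqxx].
- exists a%:M => [|g gP].
    rewrite scalar_mx22 char_poly_mx22 mul0r subr0 -mul_polyC polyCD polyCM; ring.
  have [->|/eqP ga] := eqVneq g ('X - a%:P); last first.
    by rewrite others // gtype_unit // horner_mx_scalar scalar_mx_unit // inPhi_root0.
  rewrite nua; apply: partition_size2; first exact: gtype_partition.
    by rewrite size_gtype_XsubC subrr mxrank0.
  by rewrite sumn_gtype_XsubC subrr expr0n mxrank0.
- exists (comp22 (a + b) (a * b)) => [//|g gP].
  have eig c d : c != d -> char_poly (comp22 (a + b) (a * b)) = ('X - c%:P) * ('X - d%:P) ->
      gtype (comp22 (a + b) (a * b)) ('X - c%:P) = [:: 1%N].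
    move=> cd E; set A := comp22 _ _ in E *.
    have s1 : size (gtype A ('X - c%:P)) = 1%N.
      by apply: size_gtype_root; [apply: ns|rewrite E rootM root_XsubC eqxx].
    rewrite [LHS]partition_size1 //; move: s1; rewrite size_gtype_XsubC sumn_gtype_XsubC.
    suff -> : \rank ((A - c%:M) ^+ 2) = \rank (A - c%:M)%R by move=> ->.
    (* Since [A - d] annihilates [A - c], squaring [A - c] only rescales it, and there is no second
       rank drop. *)
    have -> : (A - c%:M) ^+ 2 = (d - c) *: (A - c%:M).
      apply/eqP; rewrite -subr_eq0; apply/eqP; have := Cayley_Hamilton A.
      rewrite E rmorphM !rmorphB /= horner_mx_X !horner_mx_C => <-.
      rewrite expr2 -[X in _ - X]mul_mx_scalar -[_ *m _]/(_ * _) -mulrBr raddfB /=.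
      by rewrite opprB addrA subrK.
    by rewrite mxrank_scale_nz // subr_eq0 eq_sym.
  have [->|/eqP ga] := eqVneq g ('X - a%:P); first by rewrite nua (eig a b).
  have [->|/eqP gb] := eqVneq g ('X - b%:P).
    by rewrite nub (eig b a) // 1?eq_sym // comp_prod mulrC.
  by rewrite gtype_char_poly_2 ?others // comp_prod coprimepMr !coprimep_inPhi_XsubC.
have [fm [firr _]] := fP.
have sf : size f = 3%N by move: f2; rewrite /pdeg; case: (size f) => // k /= ->.
have fE : f = 'X ^+ 2 - (- f`_1) *: 'X + (f`_0)%:P.
  apply/polyP => i; rewrite !coefE; have := monicP fm; rewrite lead_coefE sf /=.
  case: i => [|[|[|i]]] /= fl; rewrite ?mulr0 ?mulr1 ?subr0 ?add0r ?addr0 ?opprK //.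
  by rewrite nth_default ?sf.
exists (comp22 (- f`_1) f`_0) => [|g gP]; first by rewrite comp_char -fE.
set A := comp22 _ _; have cA : char_poly A = f by rewrite comp_char -fE.
have [->|/eqP gf] := eqVneq g f.
  have fA : horner_mx A f = 0 by rewrite -cA Cayley_Hamilton.
  rewrite nuf [LHS]partition_size1; last by rewrite size_gtype f2 fA mxrank0.
  congr [:: _]; rewrite sumn_gtype fA f2 !big_ord_recl big_ord0 /rank_drop.
  by rewrite expr0 mxrank1 /= !exprS !mul0r !mxrank0.
rewrite gtype_char_poly_2 ?others // cA irreducible_poly_coprime; last by case: gP => _ [].
apply/negP => gdf; have [gm [girr _]] := gP.
have : g %= f by apply: firr.2 gdf; case: girr => g1 _; rewrite neq_ltn g1 orbT.
by rewrite eqp_monic // => /eqP.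
Qed.

(** With [C] the first two coordinate columns and [B = (N | K)], [B] has rank 2 once the columns of
    [K] fill a complement of the column space of [N = A - 1]. That complement has dimension
    [size (mp_e nu)], which is the source of the bound on the size. *)
Lemma norm2_exists nu p m : norm2_shape nu p -> p.[0] != 0 ->
  (size (mp_e nu) <= m)%N -> exists z : 'M[F]_(2 + m), has_mtype z nu.
Proof.
move=> sh p0 nm; have [A cA At] := norm2_matrix sh.
pose N := A - 1%:M; pose G := (N^T)^C%MS.
have X1 : inPhi ('X - 1 : {poly F}) by rewrite -polyC1; apply/inPhi_XsubC/oner_neq0.
have Gm : (\rank G <= m)%N.
  rewrite mxrank_compl mxrank_tr; move: nm; rewrite /mp_e -At // -polyC1.
  by rewrite size_gtype_XsubC.
(* [pid_mx] pads a basis of the complement [G] with zeros up to [m] vectors. *)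
pose K : 'M[F]_(2, m) := ((pid_mx (\rank G) : 'M_(m, \rank G)) *m row_base G)^T.
pose C : 'M[F]_(2 + m, 2) := col_mx 1%:M 0; pose B : 'M[F]_(2, 2 + m) := row_mx N K.
have BC : 1%:M + B *m C = A by rewrite mul_row_col mulmx1 mulmx0 addr0 addrC subrK.
have fC : row_full C by rewrite /row_full rank_col_mx0 mxrank1.
have fB : row_free B.
  rewrite /row_free -mxrank_tr tr_row_mx trmxK -[_ == _]/(row_full _).
  rewrite -sub1mx; apply: (@submx_trans _ _ _ _ _ _ (N^T + G)%MS).
    by rewrite sub1mx addsmx_compl_full.
  rewrite -addsmxE; apply: addsmxS => //.
  have pf : row_full (pid_mx (\rank G) : 'M[F]_(m, \rank G)).
    by rewrite /row_full rank_pid_mx.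
  by rewrite (eqmxMfull _ pf) eq_row_base.
exists (1%:M + C *m B); split.
  by rewrite unitmxE det_1addM BC det_char_poly_2 cA unitfE.
by move=> f fP; rewrite (mtype_compress fC fB) // BC At.
Qed.

Lemma struct_const_cset n xi eta nu p : xi != 0 -> eta != 0 ->
  norm2_shape nu p -> p.[0] = xi * eta -> (2 + size (mp_e nu) <= n)%N ->
  exists A : 'M[F]_2, [/\ char_poly A = p, forall f, inPhi f -> gtype A f = nu f &
    struct_const n (mp_single [:: 1%N] ('X - xi%:P)) (mp_single [:: 1%N] ('X - eta%:P)) nu
      = #|cset A xi|].
Proof.
move=> xi0 eta0 sh p0 nn; have [m nE] : exists m, n = (2 + m)%N.
  by exists (n - 2)%N; rewrite subnKC //; apply: leq_trans nn; rewrite leq_addr.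
(* The default value 0 does not occur: the bound on [n] provides an element of modified type
   [nu]. *)
subst n; rewrite /struct_const; case: pickP => [z /asboolP zt|none]; last first.
  have [||z /asboolP zt] := @norm2_exists nu p m sh; first by rewrite p0 mulf_neq0.
    by rewrite -(leq_add2l 2).
  by have := none z; rewrite zt.
have [C [B [fC fB zE cA At]]] := mtype_norm2 sh zt.
exists (1%:M + B *m C); split => //.
rewrite -(card_pairs fC fB xi0 eta0); last by rewrite det_char_poly_2 cA.
apply: eq_card => -[x y]; rewrite !inE /= zE.
by congr [&& _, _ & _]; apply/asboolP/idP => /has_mtype_reflection; apply.
Qed.

Lemma card_cset_nonscalar (A : 'M[F]_2) xi : (forall c, A <> c%:M) ->
  #|cset A xi| = (2 + #|[set s | ((char_poly A).[s] != 0%R) && (s != xi)]|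
                  + ((char_poly A).[xi] == 0%R) * (#|F| - 1))%N.
Proof.
move=> ns; have [P uP PA] := nonscalar_conj_comp22 ns.
by rewrite (card_cset_conj _ uP PA) card_cset_comp22 char_poly_2.
Qed.

Lemma card_compl_seq (D : {set F}) (s : seq F) : uniq s ->
  (forall x, (x \in D) = (x \notin s)) -> (#|D| + size s = #|F|)%N.
Proof.
move=> us Ds; rewrite addnC -(cardC [in s]) (card_uniqP us); congr (_ + _)%N.
by apply: eq_card => x; rewrite Ds.
Qed.

Lemma nonscalar_gtype (A : 'M[F]_2) : \det A != 0 ->
  (forall c, c != 0 -> size (gtype A ('X - c%:P)) <> 2%N) -> forall c, A <> c%:M.
Proof.
move=> dA sz c Ac; have c0 : c != 0.
  by move: dA; rewrite Ac det_scalar expf_eq0.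
by apply: (sz c c0); rewrite size_gtype_XsubC Ac subrr mxrank0.
Qed.

End Norm2.

(** * Evaluation of the structure constants, shape by shape *)

Theorem theorem4p4 (F : finFieldType) (xi eta xi' eta' : F) (f : {poly F}) :
  xi != 0 -> eta != 0 -> xi' != 0 -> eta' != 0 ->
  inPhi f -> pdeg f = 2%N ->
  let la := mp_single [:: 1%N] ('X - xi%:P) in
  let mu := mp_single [:: 1%N] ('X - eta%:P) in
  let q := qF F in
  (* vanishing when the determinant of the modified type differs from xi*eta *)
  (forall (nu : mpart F) (n : nat) (z : 'M[F]_n),
     is_mpart_of_norm nu 2 -> (2 + size (mp_e nu) <= n)%N ->
     has_mtype z nu -> \det z != xi * eta ->
     struct_const n la mu nu = 0%N) /\
  (* nu = (1)_{t-xi'} U (1)_{t-eta'} *)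
  (xi' * eta' = xi * eta ->
   let nu := mp_union (mp_single [:: 1%N] ('X - xi'%:P))
                      (mp_single [:: 1%N] ('X - eta'%:P)) in
   forall n : nat, (2 + size (mp_e nu) <= n)%N ->
   struct_const n la mu nu =
     (if (xi' != eta') && ~~ (((xi' == xi) && (eta' == eta)) ||
                              ((xi' == eta) && (eta' == xi)))
      then (q - 1)%N
      else if (xi' != eta') && (((xi' == xi) && (eta' == eta)) ||
                                ((xi' == eta) && (eta' == xi)))
      then (2 * q - 1)%N
      else if [&& xi' == eta', eta' == xi & xi == eta] then (q ^ 2 + q)%N
      else 0%N)) /\
  (* nu = (2)_{t-xi'} *)
  (xi' * xi' = xi * eta ->
   let nu := mp_single [:: 2%N] ('X - xi'%:P) in
   forall n : nat, (2 + size (mp_e nu) <= n)%N ->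
   struct_const n la mu nu =
     (if (xi' != xi) && (xi' != eta) then q else (2 * q)%N)) /\
  (* nu = (1)_f *)
  (f`_0 = xi * eta ->
   let nu := mp_single [:: 1%N] f in
   forall n : nat, (2 + size (mp_e nu) <= n)%N ->
   struct_const n la mu nu = q.+1).
Proof.
move=> xi0 eta0 xi'0 eta'0 fP f2 la mu q; split; [|split; [|split]].
- move=> nu n z nu2 nn zt dz; have [p sh] := norm2_shape_exists nu2.
  case: n z nn zt dz => [|n] z nn zt dz; first by [].
  (* All elements of modified type [nu] share their determinant, so the given [z] speaks for the
     element picked in [struct_const]. *)
  have detE (w : 'M[F]_n.+1) : has_mtype w nu -> \det w = p.[0].
    move=> wt; have [C [B [_ _ -> cA _]]] := mtype_norm2 sh wt.
    by rewrite det_1addM det_char_poly_2 cA.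
  rewrite /struct_const; case: pickP => // w /asboolP wt.
  apply: eq_card0 => -[x y]; rewrite inE /=; apply/negP.
  case/and3P => /asboolP/has_mtype_reflection -/(_ xi0)/andP[_ /eqP dx].
  move=> /asboolP/has_mtype_reflection -/(_ eta0)/andP[_ /eqP dy] /eqP xy.
  by move: dz; rewrite (detE z) // -(detE w) // -xy det_mulmx dx dy eqxx.
- move=> prod nu n nn.
  have nuE h : nu h = sort geq (mp_single [:: 1%N] ('X - xi'%:P) h ++
                                mp_single [:: 1%N] ('X - eta'%:P) h) by [].
  have XE (a b : F) : (('X - a%:P : {poly F}) == 'X - b%:P) = (a == b).
    by rewrite (inj_eq (addrI _)) (inj_eq oppr_inj) (inj_eq (@polyC_inj F)).
  have [E|xe] := eqVneq xi' eta'.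
    have nua : nu ('X - xi'%:P) = [:: 1%N; 1%N] by rewrite nuE -E mp_single_same.
    have sh : norm2_shape nu (('X - xi'%:P) * ('X - xi'%:P)).
      apply: (@Shape_single _ _ xi') => //; first by right.
      by move=> h hx; rewrite nuE -E mp_single_other.
    have p0 : (('X - xi'%:P) * ('X - xi'%:P)).[0] = xi * eta.
      by rewrite !hornerE mulrNN {2}E.
    have [A [cA At ->]] := struct_const_cset xi0 eta0 sh p0 nn.
    have : size (gtype A ('X - xi'%:P)) = 2%N by rewrite At ?nua //; apply: inPhi_XsubC.
    (* Two parts at [xi'] leave [A - xi'] with rank 0, so [A] is scalar. *)
    rewrite size_gtype_XsubC => rA.
    have : \rank (A - xi'%:M)%R == 0%N by move: rA; case: (\rank _) => [|[|[|]]].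
    rewrite mxrank_eq0 subr_eq0 => /eqP->; rewrite card_cset_scalar -E.
    have [xx|//] := eqVneq xi' xi; suff -> : xi == eta by [].
    by apply/eqP/(mulfI xi0); rewrite -prod -E xx.
  have nua : nu ('X - xi'%:P) = [:: 1%N].
    by rewrite nuE mp_single_same /mp_single XE (negPf xe).
  have nub : nu ('X - eta'%:P) = [:: 1%N].
    by rewrite nuE mp_single_same /mp_single XE eq_sym (negPf xe).
  have sh : norm2_shape nu (('X - xi'%:P) * ('X - eta'%:P)).
    apply: (@Shape_pair _ _ xi' eta') => //.
    by move=> h hx he; rewrite nuE !mp_single_other.
  have p0 : (('X - xi'%:P) * ('X - eta'%:P)).[0] = xi * eta.
    by rewrite !hornerE mulrNN.
  have [A [cA At ->]] := struct_const_cset xi0 eta0 sh p0 nn.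
  have pE s : ((char_poly A).[s] == 0) = (s == xi') || (s == eta').
    by rewrite cA !hornerE mulf_eq0 !subr_eq0.
  have ns : forall c, A <> c%:M.
    apply: nonscalar_gtype => [|c c0].
      by rewrite det_char_poly_2 cA !hornerE mulrNN mulf_neq0.
    rewrite At; last exact: inPhi_XsubC.
    rewrite nuE size_sort size_cat /mp_single !XE.
    have [->|_] := eqVneq c xi'; first by rewrite (negPf xe).
    by case: ifP.
  rewrite (card_cset_nonscalar _ ns) pE.
  (* As the products agree, the unordered pairs coincide as soon as [xi] is one of [xi'], [eta']. *)
  set D := [set s | _]; have -> : ((xi' == xi) && (eta' == eta)) ||
      ((xi' == eta) && (eta' == xi)) = (xi == xi') || (xi == eta').
    rewrite ![xi == _]eq_sym; apply/orP/orP => [[]/andP[]|[]/eqP E].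
    + by left.
    + by right.
    + left; rewrite E eqxx /=; apply/eqP/(mulfI xi0); by rewrite -prod E.
    right; rewrite E eqxx andbT; apply/eqP/(mulIf xi0); by rewrite mulrC -E mulrC prod E mulrC.
  (* If [xi] is an eigenvalue the count is [2 + (q - 2) + (q - 1)]; otherwise [D] omits three points
     and the count is [2 + (q - 3)]. *)
  have [xr|xr] := boolP ((xi == xi') || (xi == eta')).
    have H : (#|D| + 2 = #|F|)%N.
      apply: (@card_compl_seq _ D [:: xi'; eta']) => [|s]; first by rewrite /= inE xe.
      rewrite !inE pE; have [->|] := eqVneq s xi; first by rewrite xr.
      by rewrite andbT.
    rewrite /q /qF -H /=; lia.
  have H : (#|D| + 3 = #|F|)%N.
    apply: (@card_compl_seq _ D [:: xi; xi'; eta']) => [|s]; first by rewrite /= !inE xe xr.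
    by rewrite !inE pE -negb_or orbC.
  rewrite /q /qF -H /=; lia.
- move=> prod nu n nn.
  have nua : nu ('X - xi'%:P) = [:: 2%N] by apply: mp_single_same.
  have sh : norm2_shape nu (('X - xi'%:P) * ('X - xi'%:P)).
    apply: (@Shape_single _ _ xi') => //; first by left.
    by move=> h hx; rewrite /nu mp_single_other.
  have p0 : (('X - xi'%:P) * ('X - xi'%:P)).[0] = xi * eta.
    by rewrite !hornerE mulrNN.
  have [A [cA At ->]] := struct_const_cset xi0 eta0 sh p0 nn.
  have pE s : ((char_poly A).[s] == 0) = (s == xi').
    by rewrite cA !hornerE mulf_eq0 !subr_eq0 orbb.
  have ns : forall c, A <> c%:M.
    apply: nonscalar_gtype => [|c c0].
      by rewrite det_char_poly_2 cA !hornerE mulrNN mulf_neq0.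
    by rewrite At; [rewrite /nu /mp_single; case: ifP|exact: inPhi_XsubC].
  rewrite (card_cset_nonscalar _ ns) pE /q /qF; set D := [set s | _].
  (* The count is [2 + (q - 1) + (q - 1)] if [xi' = xi], and [2 + (q - 2)] otherwise; the product
     condition then also excludes [xi' = eta]. *)
  have [xx|xx] := eqVneq xi' xi.
    have H : (#|D| + 1 = #|F|)%N.
      apply: (@card_compl_seq _ D [:: xi']) => // s; rewrite !inE pE xx; case: eqP => //.
    rewrite xx -H /=; lia.
  have xe : xi' != eta.
    apply: contraNneq xx => xe; apply/eqP/(mulIf eta0); by rewrite -prod xe.
  have H : (#|D| + 2 = #|F|)%N.
    apply: (@card_compl_seq _ D [:: xi'; xi]) => [|s]; first by rewrite /= inE xx.
    by rewrite !inE pE negb_or.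
  rewrite xe -H /=; lia.
move=> prod nu n nn.
have nuf : nu f = [:: 1%N] by apply: mp_single_same.
have sh : norm2_shape nu f.
  apply: (@Shape_irreducible _ _ f) => //.
  by move=> h hx; rewrite /nu mp_single_other.
have p0 : f.[0] = xi * eta.
  by rewrite horner_coef0.
have [A [cA At ->]] := struct_const_cset xi0 eta0 sh p0 nn.
have pE s : ((char_poly A).[s] == 0) = false.
  rewrite cA; apply/negbTE/inPhi_root0 => // fs.
  by move: f2; rewrite fs /pdeg size_XsubC.
have ns : forall c, A <> c%:M.
  apply: nonscalar_gtype => [|c c0].
    by rewrite det_char_poly_2 cA horner_coef0 prod mulf_neq0.
  by rewrite At; [rewrite /nu /mp_single; case: ifP|exact: inPhi_XsubC].
rewrite (card_cset_nonscalar _ ns) pE /q /qF; set D := [set s | _].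
(* [f] has no roots, so only the slope [xi] is omitted and the count is [2 + (q - 1)]. *)
have H : (#|D| + 1 = #|F|)%N.
  by apply: (@card_compl_seq _ D [:: xi]) => // s; rewrite !inE pE.
rewrite -H; lia.
Qed.
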